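(* The TOIC-partition problem (given a graph $G$ and an integer $r$, decide whether $C_t^{oi}(G)\ge r$) can be solved in linear time $O(f(k)\cdot n)$, where $n$ is the order of $G$ and $f$ is a function of $k$, when restricted to graphs with clique-width at most $k$, if a $k$-expression of $G$ is provided as part of the input.
   Context: All graphs are finite, simple and undirected, with vertex set $V(G)$; the order is $|V(G)|$. A set $D\subseteq V(G)$ is a total outer-independent dominating set (TOIDS) of $G$ if every vertex of $G$ is adjacent to at least one vertex of $D$ and $V(G)\setminus D$ is an independent set of $G$. Two nonempty disjoint sets $X,Y\subseteq V(G)$ form a TOI-coalition (are TOI-coalition partners) if neither $X$ nor $Y$ is a TOIDS of $G$ but $X\cup Y$ is a TOIDS of $G$. A TOI-coalition partition of $G$ is a partition $\Psi=\{V_1,\dots,V_k\}$ of $V(G)$ into nonempty sets such that for every $V_i\in\Psi$ there exists $V_j\in\Psi$, $j\ne i$, such that $V_i$ and $V_j$ form a TOI-coalition. The TOI-coalition number $C_t^{oi}(G)$ is the maximum cardinality of a TOI-coalition partition of $G$, with $C_t^{oi}(G)=0$ if $G$ has no TOI-coalition partition. A $k$-expression of a graph $G$ is a recursive construction of $G$ using labels from $[k]=\{1,\dots,k\}$ and the following four operations: $\eta_i(v)$, which creates a graph with a single vertex $v$ labeled $i\in[k]$; $G_1\oplus G_2$, the disjoint union of two labeled graphs; $\rho_{i,j}(G)$ with $i\ne j$, which adds an edge between every vertex labeled $i$ and every vertex labeled $j$; and $\chi_{i\to j}(G)$ with $i\ne j$, which changes the label of every vertex labeled $i$ to $j$. The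 clique-width of $G$ is the smallest integer $k$ for which $G$ admits a $k$-expression.
   Formalization: The given k-expression is assumed to have at most c·n operations (any c), with time f(k)·c·n, since an arbitrarily redundant expression cannot be read in O(f(k)·n); G is given only through its k-expression, and r is a natural number. *)

(* Defs.v *)
From mathcomp Require Import all_boot.

Set Implicit Arguments.
Unset Strict Implicit.
Unset Printing Implicit Defensive.

Record sgraph := SGraph {
  vertex :> finType;
  edge : rel vertex;
  edge_sym : symmetric edge;
  edge_irrefl : irreflexive edge }.

Section Coalitions.
Variable G : sgraph.
Implicit Types (X Y D : {set G}) (Psi : {set {set G}}).

Definition toids D : bool :=
  [forall v, exists u in D, edge v u] &&
  [forall u in ~: D, forall v in ~: D, ~~ edge u v].

Definition toi_coalition X Y : bool :=
  [&& X != set0, Y != set0, [disjoint X & Y],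
      ~~ toids X, ~~ toids Y & toids (X :|: Y)].

Definition toic_partition Psi : bool :=
  partition Psi [set: G] &&
  [forall X in Psi, exists Y in Psi, (Y != X) && toi_coalition X Y].

(* The maximum of an empty family of naturals is 0, which is the convention for
   graphs without a TOI-coalition partition. *)
Definition toi_coalition_number : nat :=
  \max_(Psi : {set {set G}} | toic_partition Psi) #|Psi|.

End Coalitions.

(* Expressions over the vertex names V with label set 'I_k, i.e. the labels
   1, ..., k are shifted to 0, ..., k - 1.  The side conditions (i != j, and
   disjointness of the two arguments of a union) are in [kexpr_wf]. *)
Inductive kexpr (V : Type) (k : nat) : Type :=
  | Vertex of 'I_k & V
  | Union of kexpr V k & kexpr V k
  | Join of 'I_k & 'I_k & kexpr V k
  | Relabel of 'I_k & 'I_k & kexpr V k.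

Section Expressions.
Variables (V : finType) (k : nat).
Implicit Types e : kexpr V k.

Fixpoint kexpr_vertices e : {set V} :=
  match e with
  | Vertex _ v => [set v]
  | Union e1 e2 => kexpr_vertices e1 :|: kexpr_vertices e2
  | Join _ _ e1 | Relabel _ _ e1 => kexpr_vertices e1
  end.

Fixpoint kexpr_wf e : bool :=
  match e with
  | Vertex _ _ => true
  | Union e1 e2 =>
      [&& kexpr_wf e1, kexpr_wf e2 &
          [disjoint kexpr_vertices e1 & kexpr_vertices e2]]
  | Join i j e1 | Relabel i j e1 => (i != j) && kexpr_wf e1
  end.

(* [None] outside [kexpr_vertices e]. *)
Fixpoint kexpr_label e (u : V) : option 'I_k :=
  match e with
  | Vertex i v => if u == v then Some i else None
  | Union e1 e2 =>
      if kexpr_label e1 u is Some a then Some a else kexpr_label e2 u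
  | Join _ _ e1 => kexpr_label e1 u
  | Relabel i j e1 =>
      if kexpr_label e1 u == Some i then Some j else kexpr_label e1 u
  end.

Fixpoint kexpr_edge e (u v : V) : bool :=
  match e with
  | Vertex _ _ => false
  | Union e1 e2 => kexpr_edge e1 u v || kexpr_edge e2 u v
  | Join i j e1 =>
      [|| kexpr_edge e1 u v,
          (kexpr_label e1 u == Some i) && (kexpr_label e1 v == Some j) |
          (kexpr_label e1 u == Some j) && (kexpr_label e1 v == Some i)]
  | Relabel _ _ e1 => kexpr_edge e1 u v
  end.

(* Number of operations.  It is not bounded in terms of #|V| and k, since unary
   operations may be repeated redundantly. *)
Fixpoint kexpr_size e : nat :=
  match e with
  | Vertex _ _ => 1
  | Union e1 e2 => (kexpr_size e1 + kexpr_size e2).+1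
  | Join _ _ e1 | Relabel _ _ e1 => (kexpr_size e1).+1
  end.

(* Reverse Polish notation, one number per opcode, label or vertex name; the
   vertices are named 0, ..., #|V| - 1. *)
Fixpoint kexpr_code e : seq nat :=
  match e with
  | Vertex i v => [:: 0; nat_of_ord i; nat_of_ord (enum_rank v)]
  | Union e1 e2 => kexpr_code e1 ++ kexpr_code e2 ++ [:: 1]
  | Join i j e1 => kexpr_code e1 ++ [:: 2; nat_of_ord i; nat_of_ord j]
  | Relabel i j e1 => kexpr_code e1 ++ [:: 3; nat_of_ord i; nat_of_ord j]
  end.

End Expressions.

Definition kexpr_of (G : sgraph) (k : nat) (e : kexpr G k) : Prop :=
  [/\ kexpr_wf e, kexpr_vertices e = [set: G] & kexpr_edge e =2 @edge G].

Definition is_clique_width (G : sgraph) (w : nat) : Prop :=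
  (exists e : kexpr G w, kexpr_of e) /\
  (forall k, (exists e : kexpr G k, kexpr_of e) -> w <= k).

(* Random access machine with unit-cost instructions: registers and an
   indirectly addressed memory, both holding naturals; the only arithmetic is
   addition and truncated subtraction. *)
Inductive instr : Type :=
  | Const of nat & nat          (* Const d c   : R[d] := c *)
  | Plus of nat & nat & nat     (* Plus d a b  : R[d] := R[a] + R[b] *)
  | Minus of nat & nat & nat    (* Minus d a b : R[d] := R[a] - R[b] *)
  | Read of nat & nat           (* Read d a    : R[d] := M[R[a]] *)
  | Write of nat & nat          (* Write a b   : M[R[a]] := R[b] *)
  | JumpPos of nat & nat.       (* JumpPos a l : if R[a] > 0 goto l *)

Record config := Config {
  pc : nat;
  reg : nat -> nat;
  memory : nat -> nat }.

Definition update (m : nat -> nat) (i x : nat) : nat -> nat :=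
  fun j => if j == i then x else m j.

Definition exec (a : instr) (s : config) : config :=
  let: Config p R M := s in
  match a with
  | Const d c => Config p.+1 (update R d c) M
  | Plus d x y => Config p.+1 (update R d (R x + R y)) M
  | Minus d x y => Config p.+1 (update R d (R x - R y)) M
  | Read d x => Config p.+1 (update R d (M (R x))) M
  | Write x y => Config p.+1 R (update M (R x) (R y))
  | JumpPos x l => Config (if 0 < R x then l else p.+1) R M
  end.

(* The machine halts by leaving the program; halted configurations are
   fixpoints of [step]. *)
Definition step (P : seq instr) (s : config) : config :=
  if onth P (pc s) is Some a then exec a s else s.

Definition run (P : seq instr) (t : nat) (s : config) : config :=
  iter t (step P) s.

(* The input is in memory from address 0 on, its length in register 0; all
   other registers and memory cells are 0. *)
Definition initial (x : seq nat) : config :=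
  Config 0 (update (fun=> 0) 0 (size x)) (nth 0 x).

(* On input x, P halts after at most t steps with the answer b in register 0
   (nonzero meaning yes), and no word ever exceeds W.  The last clause confines
   the unit-cost criterion to words of O(log W) bits. *)
Definition decides_within (P : seq instr) (x : seq nat) (b : bool)
    (t W : nat) : Prop :=
  [/\ size P <= pc (run P t (initial x)),
      (0 < reg (run P t (initial x)) 0) = b
    & forall u i, reg (run P u (initial x)) i <= W /\
                  memory (run P u (initial x)) i <= W].

(* The edges of G are not listed: the expression determines them. *)
Definition toic_input (V : finType) (k r : nat) (e : kexpr V k) : seq nat :=
  k :: r :: kexpr_code e.

(* Main.v *)
Require Import Defs.
From Stdlib Require Import FunctionalExtensionality.
From mathcomp Require Import all_boot zify.

Set Implicit Arguments.
Unset Strict Implicit.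
Unset Printing Implicit Defensive.

(** The value of a graph is a maximum over annotations of its vertices by
nine letters, subject to a condition that can be checked bottom-up along an
expression with finitely many states; one random access machine carries out
the resulting dynamic programming for all [k] at once.

Coalitions.  The ends of an edge lie in at most two parts of a coalition
partition, and every coalition must contain one of these parts, because the
vertices outside a coalition are independent.  So a partition with more than
six parts has a part [A] with at least three partners; then every edge meets
[A], and [A] is a partner of every other part ([star_of_large]).  The failure
of [A] to be a TOIDS is due to some vertex of [A] all of whose neighbours lie
outside [A].  Let [u] be such a vertex with as few neighbours as possible and
[N] its neighbourhood.  Every part other than [A] meets [N], so there are at
most [#|N| + 1] parts; moreover [N] is independent and no neighbourhood is
properly contained in [N] ([min_neighbourhood]).  Conversely, in a graph
without isolated vertices these two properties make the complement of [N]
together with the singletons of [N] a coalition partition.  Hence an optimal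
partition is either given by a colouring with six colours, or by a set [N] as
above, which is described by three letters: 6 for the vertices with
neighbourhood [N], 7 for [N] and 8 for the rest.  [annotation_le] and
[annotation_exists] make this precise.

Tables.  What matters about an annotated subexpression is a set of facts such
as: some vertex with label [a] and letter [x] has no neighbour with letter
[y] or [z].  There are finitely many of them for fixed [k], and their truth
after an operation depends on their truth before it ([facts_union],
[facts_join], [facts_relabel]).  Encoded as the bits of a number, they form a
state below [width k].  The only unbounded quantity, the number of letters 7,
is additive, so that it suffices to know its maximum for every state; these
maxima form the table of the subexpression ([tableP]).

Machine.  The transitions between states must be computed by the program,
since it is the same for all [k].  They are elementary arithmetic functions,
and the class [computable] of functions that have a subroutine is closed
under iteration.  Of the cost of a subroutine one only has to know that it is
bounded in terms of a bound on the arguments, and such bounds exist because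
bounded arguments are finitely many ([value_bound]).  As labels and states
are bounded in terms of [k], an operation of the expression takes time
bounded in terms of [k]; addresses and table entries grow by such a constant
per operation, which bounds the words ([body_spec], [run_program]). *)

(** * Structured programs with bounds on time and words *)

Definition state : Type := ((nat -> nat) * (nat -> nat))%type.

Definition bounded W (s : state) := forall i, s.1 i <= W /\ s.2 i <= W.

(** Jumps in a block are relative to its first instruction; [shift o]
relocates an instruction to a block that starts at [o]. *)
Definition shift o a :=
  match a with JumpPos x l => JumpPos x (o + l) | _ => a end.

Definition placed P o C :=
  forall i a, onth C i = Some a -> onth P (o + i) = Some (shift o a).

(** The bound on words is required at every step, since the machine model
asks for it at all times. *)
Definition trace P W t c c' :=
  run P t c = c' /\
  forall u, u <= t -> bounded W (reg (run P u c), memory (run P u c)).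

(** In [While r z p] the scratch register [z] receives a 1: the machine only
has conditional jumps, and entering the loop at its test needs an
unconditional one. *)
Inductive prog :=
  | Line of seq instr
  | Seq of prog & prog
  | While of nat & nat & prog.

Fixpoint compile p :=
  match p with
  | Line l => l
  | Seq p q => compile p ++ map (shift (size (compile p))) (compile q)
  | While r z p =>
      [:: Const z 1; JumpPos z (size (compile p) + 2)] ++
      map (shift 2) (compile p) ++ [:: JumpPos r 2]
  end.

Definition effect a (s : state) : state :=
  match a with
  | Const d c => (update s.1 d c, s.2)
  | Plus d x y => (update s.1 d (s.1 x + s.1 y), s.2)
  | Minus d x y => (update s.1 d (s.1 x - s.1 y), s.2)
  | Read d x => (update s.1 d (s.2 (s.1 x)), s.2)
  | Write x y => (s.1, update s.2 (s.1 x) (s.1 y))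
  | JumpPos _ _ => s
  end.

Definition safe W a (s : state) : Prop :=
  match a with
  | Const _ c => c <= W
  | Plus _ x y => s.1 x + s.1 y <= W
  | JumpPos _ _ => False
  | _ => True
  end.

(** Weakest precondition for total correctness in at most [t] steps, all
words staying below [W].  Code is position independent, so that the statement
quantifies over the programs that contain it. *)
Definition wp W t p (Q : state -> Prop) (s : state) :=
  bounded W s ->
  exists s' t', [/\ t' <= t, Q s' & forall P o, placed P o (compile p) ->
    trace P W t' (Config o s.1 s.2) (Config (o + size (compile p)) s'.1 s'.2)].

Lemma onth_cat_l T (s1 s2 : seq T) i a : onth s1 i = Some a -> onth (s1 ++ s2) i = Some a.
Proof. by elim: s1 i => [|x s1 IH] [|i] //=; apply: IH. Qed.

Lemma onth_cat_r T (s1 s2 : seq T) i : onth (s1 ++ s2) (size s1 + i) = onth s2 i.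
Proof. by elim: s1. Qed.

Lemma shiftD o o' a : shift o (shift o' a) = shift (o + o') a.
Proof. by case: a => //= x l; rewrite addnA. Qed.

Lemma placed_cat P o C1 C2 : placed P o (C1 ++ C2) ->
  placed P o C1 /\ (forall i a, onth C2 i = Some a -> onth P (o + size C1 + i) = Some (shift o a)).
Proof.
move=> H; split=> i a Ha; first by apply: H; apply: onth_cat_l.
by rewrite -addnA; apply: H; rewrite onth_cat_r.
Qed.

Lemma onth_shift C m i a : onth C i = Some a -> onth (map (shift m) C) i = Some (shift m a).
Proof. by elim: C i => [|x C IH] [|i] //= => [[->]|] //; apply: IH. Qed.

Lemma placed_seq P o C1 C2 : placed P o (C1 ++ map (shift (size C1)) C2) ->
  placed P o C1 /\ placed P (o + size C1) C2.
Proof.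
move=> /placed_cat[H1 H2]; split=> // i a Ha.
by rewrite (H2 _ _ (onth_shift _ Ha)) shiftD.
Qed.

Lemma runD P t1 t2 c : run P (t1 + t2) c = run P t2 (run P t1 c).
Proof. by rewrite /run addnC iterD. Qed.

Lemma trace_trans P W t1 t2 c c1 c2 :
  trace P W t1 c c1 -> trace P W t2 c1 c2 -> trace P W (t1 + t2) c c2.
Proof.
case=> [E1 B1] [E2 B2]; split; first by rewrite runD E1.
move=> u Hu; case: (leqP u t1) => [|lt1]; first exact: B1.
by rewrite -(subnKC (ltnW lt1)) runD E1; apply: B2; lia.
Qed.

Lemma trace0 P W o s : bounded W s -> trace P W 0 (Config o s.1 s.2) (Config o s.1 s.2).
Proof. by move=> B; split=> // u; rewrite leqn0 => /eqP ->. Qed.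

Lemma trace1 P W o o' (s s' : state) : bounded W s ->
  step P (Config o s.1 s.2) = Config o' s'.1 s'.2 -> bounded W s' ->
  trace P W 1 (Config o s.1 s.2) (Config o' s'.1 s'.2).
Proof. by move=> B E B'; split=> [|[|[|u]]] //= _; rewrite ?E. Qed.

Lemma bounded_effect W a s : safe W a s -> bounded W s -> bounded W (effect a s).
Proof.
have upd (f : nat -> nat) d x : (forall i, f i <= W) -> x <= W -> forall i, update f d x i <= W.
  by move=> Hf Hx i; rewrite /update; case: ifP.
case: s => R M Ha B.
have [BR BM] : (forall i, R i <= W) /\ (forall i, M i <= W) by split=> i; case: (B i).
case: a Ha => [d c|d x y|d x y|d x|x y|x l] //= Ha i; split=> //=; apply: upd => //.
exact: leq_trans (leq_subr _ _) (BR x).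
Qed.

Lemma step_effect P W o a s : safe W a s -> onth P o = Some a ->
  step P (Config o s.1 s.2) = Config o.+1 (effect a s).1 (effect a s).2.
Proof. by case: s => R M; rewrite /step /= => + ->; case: a. Qed.

Lemma shift_safe W o a s : safe W a s -> shift o a = a.
Proof. by case: a. Qed.

(** For straight-line code the weakest precondition is computed by symbolic
execution; only [Const] and [Plus] can produce a word above [W]. *)
Fixpoint line W l (s : state) (Q : state -> Prop) : Prop :=
  if l is a :: l' then safe W a s /\ line W l' (effect a s) Q else Q s.

Lemma wp_line W l Q s : line W l s Q -> wp W (size l) (Line l) Q s.
Proof.
move=> H B.
suff [s' [HQ Hr]] : exists s', Q s' /\ forall P o o0,
    (forall i a, onth l i = Some a -> onth P (o + i) = Some (shift o0 a)) ->
    trace P W (size l) (Config o s.1 s.2) (Config (o + size l) s'.1 s'.2).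
  by exists s', (size l); split=> // P o; apply: Hr.
elim: l s H B => [|a l IH] s /= H B.
  by exists s; split=> // P o o0 _; rewrite addn0; apply: trace0.
case: H => Ha H; have B' := bounded_effect Ha B.
have [s' [HQ Hr]] := IH _ H B'; exists s'; split=> // P o o0 Hp.
have Hpa : onth P o = Some a.
  by have := Hp 0 a erefl; rewrite addn0 (shift_safe _ Ha).
rewrite -(addSnnS o) -(add1n (size l)).
apply: trace_trans (Hr _ o.+1 o0 _); last by move=> i b Hb; rewrite addSnnS; apply: Hp.
exact: trace1 B (step_effect Ha Hpa) B'.
Qed.

Lemma placed_self C : placed C 0 C.
Proof. by move=> i a; rewrite add0n; case: a. Qed.

Lemma wp_bounded W t p Q s : wp W t p Q s -> wp W t p (fun s' => bounded W s' /\ Q s') s.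
Proof.
move=> H B; have [s' [u [Hu HQ Hr]]] := H B.
exists s', u; split=> //; split=> //.
by have [E /(_ u (leqnn u))] := Hr _ _ (@placed_self _); rewrite E; case: (s').
Qed.

Lemma wp_mono W t t' p (Q Q' : state -> Prop) s :
  t <= t' -> (forall s', bounded W s' -> Q s' -> Q' s') -> wp W t p Q s -> wp W t' p Q' s.
Proof.
move=> le_t QQ' /wp_bounded H B; have [s' [u [Hu [B' HQ] Hr]]] := H B.
by exists s', u; split=> //; [apply: leq_trans le_t|apply: QQ'].
Qed.

Lemma wp_le W t t' p Q s : t <= t' -> wp W t p Q s -> wp W t' p Q s.
Proof. by move=> le; apply: wp_mono le _. Qed.

Lemma wp_line_le W t l Q s : line W l s Q -> size l <= t -> wp W t (Line l) Q s.
Proof. by move=> /wp_line H le; apply: wp_mono H. Qed.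

Lemma wp_seq W t1 t2 p q Q s :
  wp W t1 p (fun s1 => wp W t2 q Q s1) s -> wp W (t1 + t2) (Seq p q) Q s.
Proof.
move=> /wp_bounded H B; have [s1 [u1 [Hu1 [B1 H1] Hr1]]] := H B.
have [s2 [u2 [Hu2 H2 Hr2]]] := H1 B1.
exists s2, (u1 + u2); split=> //; first exact: leq_add.
move=> P o /= /placed_seq[/Hr1 T1 /Hr2 T2].
by rewrite size_cat size_map addnA; apply: trace_trans T1 T2.
Qed.

(** The invariant is indexed by the number of iterations that remain, which
is also what bounds the time. *)
Lemma wp_while W t n r z p (Inv : nat -> state -> Prop) Q s :
  (forall m s, Inv m.+1 s -> 0 < s.1 r /\ wp W t p (Inv m) s) ->
  (forall s, Inv 0 s -> s.1 r = 0 /\ Q s) ->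
  0 < W -> Inv n (update s.1 z 1, s.2) ->
  wp W (n * t.+1 + 3) (While r z p) Q s.
Proof.
move=> Hstep Hend W0 Hn B.
set C := compile p.
set s1 : state := (update s.1 z 1, s.2).
have B1 : bounded W s1 by apply: (@bounded_effect W (Const z 1) s).
have Hback P o : placed P o (compile (While r z p)) ->
    onth P (o + 2 + size C) = Some (JumpPos r (o + 2)).
  move=> Hp; rewrite -addnA; apply: (Hp _ (JumpPos r 2)).
  by rewrite /= -(addn0 (size C)) -(size_map (shift 2)) onth_cat_r.
have [s' [u [Hu HQ Hr]]] : exists s' u, [/\ u <= n * t.+1 + 1, Q s' &
    forall P o, placed P o (compile (While r z p)) ->
    trace P W u (Config (o + 2 + size C) s1.1 s1.2)
      (Config (o + size (compile (While r z p))) s'.1 s'.2)].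
  move: Hn; rewrite -/s1 => Hn; elim: n (s1) B1 Hn => [|n IH] s0 B0 Hn.
    have [r0 HQ] := Hend _ Hn.
    exists s0, 1; split=> // P o Hp; apply: (trace1 B0 _ B0).
    by rewrite /step /= (Hback _ _ Hp) /= r0 /= size_cat size_map /=; rewrite -/C; congr Config; lia.
  have [r0 /wp_bounded /(_ B0) [s2 [u2 [Hu2 [B2 H2] Hr2]]]] := Hstep _ _ Hn.
  have [s3 [u3 [Hu3 H3 Hr3]]] := IH _ B2 H2.
  exists s3, (1 + u2 + u3); split=> //; first by rewrite mulSn; lia.
  move=> P o Hp; apply: trace_trans (Hr3 _ _ Hp).
  apply: (@trace_trans _ _ _ _ _ (Config (o + 2) s0.1 s0.2)).
    apply: (trace1 B0 _ B0).
    by rewrite /step /= (Hback _ _ Hp) /= r0.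
  apply: Hr2 => i a Ha.
  have := Hp (2 + i) (shift 2 a); rewrite /= addnA => -> //; first by rewrite shiftD.
  by apply: onth_cat_l; apply: onth_shift.
exists s', (2 + u); split=> //; first lia.
move=> P o Hp; apply: trace_trans (Hr _ _ Hp).
apply: (@trace_trans _ _ 1 1 _ (Config o.+1 s1.1 s1.2)).
  apply: (trace1 B _ B1).
  by rewrite /step /=; have := Hp 0 _ erefl; rewrite addn0 => ->.
apply: (trace1 B1 _ B1).
have Hjump : onth P o.+1 = Some (JumpPos z (o + (size C + 2))).
  by rewrite -addn1; apply: (Hp 1 (JumpPos z (size C + 2))).
rewrite /step [pc _]/= Hjump /= /update eqxx /=; congr Config; lia.
Qed.

(** The scratch register [z] serves for the jump and for the constant 1. *)
Definition For i c z b p :=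
  Seq (Line [:: Const i 0; Const c 0; Plus c c b])
      (While c z (Seq p (Line [:: Const z 1; Plus i i z; Minus c c z]))).

(** The invariant must not depend on the registers of the loop itself, which
change between two executions of the body. *)
Lemma wp_for W t n (i c z b : nat) p (Inv : nat -> state -> Prop) Q (s : state) :
  uniq [:: i; c; z; b] -> s.1 b = n -> n < W ->
  (forall m s1 s2, s1.2 = s2.2 ->
     (forall y, y \notin [:: i; c; z] -> s2.1 y = s1.1 y) -> Inv m s1 -> Inv m s2) ->
  Inv 0 s ->
  (forall m s, m < n -> s.1 i = m -> Inv m s ->
     wp W t p (fun s' => [/\ Inv m.+1 s', s'.1 i = m & s'.1 c = s.1 c]) s) ->
  (forall s, Inv n s -> Q s) ->
  wp W (n * (t + 4) + 6) (For i c z b p) Q s.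
Proof.
move=> U bn nW Hinv I0 Hp HQ.
move: U; rewrite /= !inE !negb_or => /and4P[/and3P[ic iz ib] /andP[cz cb] zb _].
have NE := (negPf ic, negPf iz, negPf ib, negPf cz, negPf cb, negPf zb).
have sym (x y : nat) : x != y -> (y == x) = false by rewrite eq_sym => /negPf.
have NE' := (sym _ _ ic, sym _ _ iz, sym _ _ ib, sym _ _ cz, sym _ _ cb, sym _ _ zb).
pose J j (s : state) := [/\ j <= n, s.1 c = j, s.1 i = n - j & Inv (n - j) s].
have -> : n * (t + 4) + 6 = 3 + (n * (t + 3).+1 + 3) by lia.
apply: wp_seq; apply: (@wp_line _ [:: _; _; _]) => /=.
rewrite /update ?eqxx ?NE ?NE' /= ?eqxx bn add0n. do 3! (split; first lia).
apply: (@wp_while _ _ n _ _ _ J); last 1 first.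
- rewrite /J /update /= ?eqxx ?NE ?NE' ?subnn; split=> //.
  by apply: Hinv I0 => //= y; rewrite !inE /update !negb_or => /and3P[/negPf-> /negPf-> /negPf->].
- move=> j s1 [lejn cj ij Ij]; split; first by rewrite cj.
  apply: wp_seq; apply: wp_mono (Hp (n - j.+1) _ _ ij Ij); [by []| |by lia].
  move=> s2 _ [Ij' i2 c2]; apply: (@wp_line _ [:: _; _; _]) => /=.
  rewrite /update ?eqxx ?NE ?NE' /= ?eqxx; do 3! (split; first lia).
  rewrite /J /= ?eqxx ?NE ?NE' ?eqxx; split; [lia|lia|lia|].
  have -> : n - j = (n - j.+1).+1 by lia.
  apply: Hinv Ij' => //= y; rewrite !inE !negb_or => /and3P[y1 y2 y3].
  by rewrite /update (negPf y1) (negPf y2) (negPf y3).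
- by move=> s1 [_ c0 _]; rewrite subn0 => /HQ.
- lia.
Qed.

(** A loop that clears its own condition. *)
Definition If r z p := While r z (Seq p (Line [:: Const r 0])).

Lemma wp_if W t (r z : nat) p Q (s : state) : 0 < W -> r != z ->
  (s.1 r = 0 -> Q (update s.1 z 1, s.2)) ->
  (0 < s.1 r -> wp W t p (fun s' => Q (update s'.1 r 0, s'.2)) (update s.1 z 1, s.2)) ->
  wp W (t + 5) (If r z p) Q s.
Proof.
move=> W0 rz H0 H1.
pose J j (s' : state) := if j is 0 then s'.1 r = 0 /\ Q s' else
  [/\ j = 1, 0 < s'.1 r & s' = (update s.1 z 1, s.2)].
have Hstep m s' : J m.+1 s' -> 0 < s'.1 r /\
    wp W (t + 1) (Seq p (Line [:: Const r 0])) (J m) s'.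
  move=> [[->] r1 E]; split=> //; rewrite E; apply: wp_seq.
  apply: wp_mono (H1 _) => // [s2 _ Q2|]; last first.
    by move: r1; rewrite E /= /update (negPf rz).
  by apply: (@wp_line _ [:: _]); rewrite /= /update eqxx.
have [r0|r0] := posnP (s.1 r).
  have := @wp_while W (t + 1) 0 r z _ J Q s Hstep; rewrite mul0n.
  move=> /(_ (fun _ => id) W0) H; apply: wp_mono (H _) => //; first by lia.
  by rewrite /J /= /update (negPf rz); split=> //; apply: H0.
have -> : t + 5 = 1 * (t + 1).+1 + 3 by lia.
apply: (@wp_while _ _ _ _ _ _ J _ _ Hstep (fun _ => id) W0).
by rewrite /J /= /update (negPf rz).
Qed.


(** * Functions with a subroutine *)

(** The class of functions of an environment [e], the values of the variables,
that have a subroutine.  Variable [i] is in register [xs i]; the result goes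
to register [d], above all of them, and the registers below [d] are kept.
Time and words are bounded by a function [T] of a bound on the variables.
Functions of two and more variables are written as functions of [e 0], [e 1]
and so on, which makes composition and the shift of variables under a binder
a matter of conversion. *)
Definition computable (f : (nat -> nat) -> nat) :=
  forall d xs, (forall i, xs i < d) ->
  exists p T, forall b W (s : state) (Q : state -> Prop),
    (forall i, s.1 (xs i) <= b) -> T b <= W ->
    (forall s', s'.1 d = f (s.1 \o xs) -> (forall y, y < d -> s'.1 y = s.1 y) ->
       s'.2 = s.2 -> Q s') ->
    wp W (T b) p Q s.

(** Environments bounded by [b] take only finitely many values on the finitely
many registers below [d]. *)
Lemma value_bound (f : (nat -> nat) -> nat) d (xs : nat -> nat) : (forall i, xs i < d) ->
  exists V : nat -> nat, forall b R, (forall i, R (xs i) <= b) -> f (R \o xs) <= V b.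
Proof.
move=> Hxs.
pose env b (g : {ffun 'I_d -> 'I_b.+1}) i : nat := g (Ordinal (Hxs i)).
exists (fun b => \max_(g : {ffun 'I_d -> 'I_b.+1}) f (env b g)) => b R HR.
pose g := [ffun j : 'I_d => inord (R j) : 'I_b.+1].
suff -> : R \o xs = env b g by apply: leq_bigmax.
apply: functional_extensionality => i.
by rewrite /env ffunE /= inordK ?ltnS.
Qed.

Lemma computable_ext f g : computable f -> f =1 g -> computable g.
Proof.
by move=> Hf fg; have <- : f = g by apply: functional_extensionality.
Qed.

Lemma computable_var i : computable (fun e => e i).
Proof.
move=> d xs Hxs; exists (Line [:: Const d 0; Plus d d (xs i)]), (fun b => b.+2).
move=> b W s Q Hb HW HQ; apply: wp_line_le => //=.
have ne : (xs i == d) = false by rewrite ltn_eqF.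
rewrite /update ne eqxx; split; first lia.
split; first by have := Hb i; lia.
by apply: HQ => //= [|y yd]; rewrite ?eqxx // ?(ltn_eqF yd).
Qed.

Lemma computable_const c : computable (fun _ => c).
Proof.
move=> d xs Hxs; exists (Line [:: Const d c]), (fun b => c.+1).
move=> b W s Q Hb HW HQ; apply: wp_line_le => //=.
split; first lia.
by apply: HQ => //= [|y yd]; rewrite /update ?eqxx // (ltn_eqF yd).
Qed.

(** The common form of the instructions [Plus] and [Minus]. *)
Lemma computable_binary (op : nat -> nat -> nat) (ins : nat -> nat -> nat -> instr) f g :
  (forall d x y (s : state), effect (ins d x y) s = (update s.1 d (op (s.1 x) (s.1 y)), s.2)) ->
  (forall W d x y (s : state), s.1 x + s.1 y <= W -> safe W (ins d x y) s) ->
  computable f -> computable g -> computable (fun e => op (f e) (g e)).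
Proof.
move=> Heff Hsafe Hf Hg d xs Hxs.
have Hxs' i : xs i < d.+1 by rewrite ltnW ?ltnS.
have [pf [Tf Ef]] := Hf d xs Hxs.
have [pg [Tg Eg]] := Hg d.+1 xs Hxs'.
have [Vf Bf] := value_bound f Hxs; have [Vg Bg] := value_bound g Hxs.
exists (Seq pf (Seq pg (Line [:: ins d d d.+1]))).
exists (fun b => Tf b + (Tg b + (1 + Vf b + Vg b))) => b W s Q Hb HW HQ.
apply: wp_seq; apply: (Ef _ _ _ _ Hb) => [|s1 d1 low1 mem1]; first lia.
have Hlow1 i : s1.1 (xs i) = s.1 (xs i) by rewrite low1.
apply: wp_seq; apply: Eg => [i||s2 d2 low2 mem2]; [by rewrite Hlow1; apply: Hb|lia|].
have e2 : g (s1.1 \o xs) = g (s.1 \o xs).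
  by congr g; apply: functional_extensionality => i; apply: Hlow1.
rewrite e2 in d2; have d2' : s2.1 d = f (s.1 \o xs) by rewrite low2.
apply: wp_line_le => //=.
split; first by apply: Hsafe; rewrite d2 d2'; have := Bf _ _ Hb; have := Bg _ _ Hb; lia.
rewrite Heff; apply: HQ => //= [|y yd|]; last by rewrite mem2.
  by rewrite /update eqxx d2 d2'.
by rewrite /update (ltn_eqF yd) low2 ?low1 // ltnW.
Qed.

Lemma computable_add f g : computable f -> computable g -> computable (fun e => f e + g e).
Proof. exact: (@computable_binary addn Plus). Qed.

Lemma computable_sub f g : computable f -> computable g -> computable (fun e => f e - g e).
Proof.
by apply: (@computable_binary subn Minus).
Qed.

(** Primitive recursion.  The body [s] sees the index as variable 0, the
accumulator as variable 1 and the variables of the context from 2 on. *)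
Lemma computable_iteri n z (s : nat -> nat -> (nat -> nat) -> nat) :
  computable n -> computable z -> computable (fun e => s (e 0) (e 1) (fun i => e i.+2)) ->
  computable (fun e => iteri (n e) (fun i a => s i a e) (z e)).
Proof.
move=> Hn Hz Hs d xs Hxs.
have Hxs2 i : xs i < d.+2 by have := Hxs i; lia.
pose xs' i := if i is j.+1 then if j is l.+1 then xs l else d else d.+1.
have Hxs' i : xs' i < d.+3 by case: i => [|[|i]] /=; [lia|lia|have := Hxs i; lia].
have [pz [Tz Ez]] := Hz d xs Hxs.
have [pn [Tn En]] := Hn d.+2 xs Hxs2.
have [ps [Ts Es]] := Hs d.+3 xs' Hxs'.
have [Vn Bn] := value_bound n Hxs.
pose it e m := iteri m (fun i a => s i a e) (z e).
have [Va Ba] := value_bound (fun e => \sum_(m < (n e).+1) it e m) Hxs.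
(* The body sees the index and the accumulator besides the variables. *)
pose b' b := b + Vn b + Va b.
exists (Seq pz (Seq pn (Seq (Line [:: Const d.+1 0])
  (While d.+2 d.+3 (Seq ps (Line [:: Const d.+4 0; Plus d d.+3 d.+4; Const d.+4 1;
    Plus d.+1 d.+1 d.+4; Minus d.+2 d.+2 d.+4])))))).
exists (fun b => Tz b + (Tn b + (1 + (Vn b * (Ts (b' b) + 5).+1 + 3 + Vn b + Va b + Ts (b' b))))).
move=> b W s0 Q Hb HW HQ.
set N := n (s0.1 \o xs); have leN : N <= Vn b by apply: Bn.
pose A m := it (s0.1 \o xs) m.
have leA m : m <= N -> A m <= Va b.
  move=> lem; apply: leq_trans (Ba _ _ Hb).
  by rewrite (bigD1 (inord m)) //= inordK ?leq_addr.
apply: wp_seq; apply: (Ez _ _ _ _ Hb) => [|s1 d1 low1 mem1]; first lia.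
have Hlow1 i : s1.1 (xs i) = s0.1 (xs i) by rewrite low1.
have env1 : s1.1 \o xs = s0.1 \o xs by apply: functional_extensionality => i; apply: Hlow1.
apply: wp_seq; apply: En => [i||s2 d2 low2 mem2]; [by rewrite Hlow1; apply: Hb|lia|].
rewrite env1 -/N in d2.
apply: wp_seq; apply: (@wp_line _ [:: _]) => /=; split=> //.
pose Inv m (s' : state) := [/\ m <= N, s'.1 d.+2 = m, s'.1 d.+1 = N - m, s'.1 d = A (N - m) &
   (forall y, y < d -> s'.1 y = s0.1 y) /\ s'.2 = s0.2].
have le : N * (Ts (b' b) + 5).+1 + 3 <= Vn b * (Ts (b' b) + 5).+1 + 3 + Vn b + Va b + Ts (b' b).
  by have := leq_mul leN (leqnn (Ts (b' b) + 5).+1); lia.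
apply: wp_mono le (fun _ _ => id) _.
apply: (@wp_while _ _ _ _ _ _ Inv).
- move=> m s3 [lem c3 i3 a3 [low3 mem3]]; split; first by rewrite c3.
  apply: wp_seq; apply: Es => [i||s4 d4 low4 mem4].
  + rewrite /b'; case: i => [|[|i]] /=; first by rewrite i3; lia.
      by rewrite a3; have := leA (N - m.+1); lia.
    by rewrite low3 //; have := Hb i; lia.
  + lia.
  have E4 : s4.1 d.+3 = A (N - m).
    rewrite d4 /=; have -> : N - m = (N - m.+1).+1 by lia.
    rewrite /A /it iteriS i3 a3; congr s.
    by apply: functional_extensionality => i /=; rewrite low3.
  have H1 : s4.1 d.+1 = N - m.+1 by rewrite low4 ?i3.
  have H2 : s4.1 d.+2 = m.+1 by rewrite low4 ?c3.
  apply: (@wp_line _ [:: _; _; _; _; _]) => /=.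
  have D j : ((d == (d + j).+1) = false) * (((d + j).+1 == d) = false).
    by split; apply/eqP; lia.
  have := (D 0, D 1, D 2, D 3); rewrite !(addn0, addn1, addn2, addn3) => NE.
  rewrite /update; rewrite ?eqSS ?NE ?eqxx.
  have A4 : A (N - m) <= Va b by apply: leA; lia.
  split=> //; split; first by rewrite E4; lia.
  split; first lia; split; first by rewrite H1; lia.
  split=> //; rewrite /Inv /=; rewrite ?eqSS ?NE ?eqxx; split; [lia|lia|lia|lia|].
  split=> [y yd|]; last by rewrite mem4.
  have Y j : (y == d + j) = false by apply/eqP; lia.
  have := (Y 0, Y 1, Y 2, Y 3, Y 4); rewrite !(addn0, addn1, addn2, addn3, addn4) => {}Y.
  by rewrite !Y low4 ?low3 //; lia.
- move=> s3 [_ c3 _ a3 [low3 mem3]]; split=> //; apply: HQ => //.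
  by rewrite a3 subn0.
- lia.
have D j : ((d == (d + j).+1) = false) * (((d + j).+1 == d) = false).
  by split; apply/eqP; lia.
have := (D 0, D 1, D 2, D 3); rewrite !(addn0, addn1, addn2, addn3) => NE.
rewrite /Inv /update /=; rewrite ?eqSS ?NE ?eqxx; split; [by []|by []|lia| |].
  by rewrite low2 // d1 subnn.
split=> [y yd|]; last by rewrite mem2.
have Y j : (y == d + j) = false by apply/eqP; lia.
have := (Y 0, Y 1, Y 2, Y 3, Y 4); rewrite !(addn0, addn1, addn2, addn3, addn4) => {}Y.
by rewrite !Y low2 ?low1 //; lia.
Qed.

Lemma computable_compose2 (h : nat -> nat -> nat) f g :
  computable (fun e => h (e 0) (e 1)) -> computable f -> computable g ->
  computable (fun e => h (f e) (g e)).
Proof.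
move=> Hh Hf Hg d xs Hxs.
have Hxs1 i : xs i < d.+1 by rewrite ltnW ?ltnS.
pose xs' i := if i is 0 then d else d.+1.
have Hxs' i : xs' i < d.+2 by case: i => [|i] /=; lia.
have [pf [Tf Ef]] := Hf d xs Hxs.
have [pg [Tg Eg]] := Hg d.+1 xs Hxs1.
have [ph [Th Eh]] := Hh d.+2 xs' Hxs'.
have [Vf Bf] := value_bound f Hxs; have [Vg Bg] := value_bound g Hxs.
have [Vh Bh] := value_bound (fun e => h (f e) (g e)) Hxs.
pose b' b := Vf b + Vg b.
exists (Seq pf (Seq pg (Seq ph (Line [:: Const d 0; Plus d d d.+2])))).
exists (fun b => Tf b + (Tg b + (Th (b' b) + (2 + Vh b)))) => b W s Q Hb HW HQ.
apply: wp_seq; apply: (Ef _ _ _ _ Hb) => [|s1 d1 low1 mem1]; first lia.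
have Hlow1 i : s1.1 (xs i) = s.1 (xs i) by rewrite low1.
have env1 : s1.1 \o xs = s.1 \o xs by apply: functional_extensionality => i; apply: Hlow1.
apply: wp_seq; apply: Eg => [i||s2 d2 low2 mem2]; [by rewrite Hlow1; apply: Hb|lia|].
rewrite env1 in d2; have d2' : s2.1 d = f (s.1 \o xs) by rewrite low2.
apply: wp_seq; apply: Eh => [i||s3 d3 low3 mem3].
- have := Bf _ _ Hb; have := Bg _ _ Hb; rewrite /b'.
  by case: i => [|i] /=; rewrite ?d2 ?d2'; lia.
- lia.
have {}d3 : s3.1 d.+2 = h (f (s.1 \o xs)) (g (s.1 \o xs)) by rewrite d3 /= d2 d2'.
apply: wp_line_le => //=; split=> //.
have D : (d.+2 == d) = false by apply/eqP; lia.
rewrite /update eqxx D add0n; split; first by rewrite d3; have := Bh _ _ Hb; lia.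
apply: HQ => //= [|y yd|]; rewrite ?eqxx ?mem3 ?mem2 //.
by rewrite (ltn_eqF yd) low3 ?low2 ?low1 //; lia.
Qed.

Lemma computable_mul f g : computable f -> computable g -> computable (fun e => f e * g e).
Proof.
apply: (computable_compose2 (h := muln)).
apply: (computable_ext (f := fun e => iteri (e 0) (fun _ a => a + e 1) 0)).
  apply: (@computable_iteri (fun e => e 0) (fun=> 0) (fun _ a e => a + e 1)).
  - exact: computable_var.
  - exact: computable_const.
  - by apply: computable_add; apply: computable_var.
by move=> e; elim: (e 0) => //= n ->; rewrite addnC.
Qed.

Lemma computable_if (c : (nat -> nat) -> bool) f g :
  computable (fun e => c e) -> computable f -> computable g ->
  computable (fun e => if c e then f e else g e).
Proof.
move=> Hc Hf Hg.
apply: (computable_ext (f := fun e => (1 - c e) * g e + c e * f e)).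
  apply: computable_add; apply: computable_mul => //.
  by apply: computable_sub => //; apply: computable_const.
by move=> e; case: (c e); rewrite /= ?mul1n ?addn0.
Qed.

(** Weakening and exchange of variables, as needed under a binder. *)
Lemma computable_reindex f (phi : nat -> nat) :
  computable f -> computable (fun e => f (fun i => e (phi i))).
Proof.
move=> Hf d xs Hxs; have [|p [T E]] := Hf d (xs \o phi); first by move=> i; apply: Hxs.
by exists p, T => b W s Q Hb; apply: E => i; apply: Hb.
Qed.

Lemma computable_negb (c : (nat -> nat) -> bool) :
  computable (fun e => c e) -> computable (fun e => ~~ c e).
Proof.
move=> Hc; apply: (computable_ext (f := fun e => 1 - c e)); last by move=> e; case: (c e).
by apply: computable_sub => //; apply: computable_const.
Qed.

Lemma computable_andb (c1 c2 : (nat -> nat) -> bool) :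
  computable (fun e => c1 e) -> computable (fun e => c2 e) ->
  computable (fun e => c1 e && c2 e).
Proof.
move=> H1 H2; apply: (computable_ext (f := fun e => c1 e * c2 e)); last by move=> e; rewrite mulnb.
exact: computable_mul.
Qed.

Lemma computable_orb (c1 c2 : (nat -> nat) -> bool) :
  computable (fun e => c1 e) -> computable (fun e => c2 e) ->
  computable (fun e => c1 e || c2 e).
Proof.
move=> H1 H2; apply: (computable_ext (f := fun e => ~~ (~~ c1 e && ~~ c2 e))).
  by apply/computable_negb/computable_andb; apply: computable_negb.
by move=> e; rewrite negb_and !negbK.
Qed.

Lemma computable_leq f g : computable f -> computable g -> computable (fun e => f e <= g e).
Proof.
move=> Hf Hg; apply: (computable_ext (f := fun e => 1 - (f e - g e))).
  by do 2?apply: computable_sub => //; apply: computable_const.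
by move=> e; lia.
Qed.

Lemma computable_succ f : computable f -> computable (fun e => (f e).+1).
Proof.
move=> Hf; apply: (computable_ext (f := fun e => f e + 1)); last by move=> e; rewrite addn1.
by apply: computable_add => //; apply: computable_const.
Qed.

Lemma computable_ltn f g : computable f -> computable g -> computable (fun e => f e < g e).
Proof.
by move=> Hf Hg; apply: computable_leq => //; apply: computable_succ.
Qed.

Lemma computable_eq f g : computable f -> computable g -> computable (fun e => f e == g e).
Proof.
move=> Hf Hg; apply: (computable_ext (f := fun e => (f e <= g e) && (g e <= f e))).
  by apply: computable_andb; apply: computable_leq.
by move=> e; rewrite -eqn_leq.
Qed.

Lemma computable_all n (P : nat -> (nat -> nat) -> bool) :
  computable n -> computable (fun e => P (e 0) (fun i => e i.+1)) ->
  computable (fun e => all (P^~ e) (iota 0 (n e))).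
Proof.
move=> Hn HP; apply: (computable_ext
    (f := fun e => iteri (n e) (fun i a => a * P i e) 1)); last first.
  move=> e; elim: (n e) => // m IH.
  by rewrite iteriS IH mulnb -[m.+1]addn1 iotaD all_cat /= andbT.
apply: computable_iteri => //; first exact: computable_const.
apply: computable_mul; first exact: computable_var.
exact: (computable_reindex (fun i => if i is j.+1 then j.+2 else 0) HP).
Qed.

Lemma computable_sum n (F : nat -> (nat -> nat) -> nat) :
  computable n -> computable (fun e => F (e 0) (fun i => e i.+1)) ->
  computable (fun e => \sum_(0 <= x < n e) F x e).
Proof.
move=> Hn HF; apply: (computable_ext
    (f := fun e => iteri (n e) (fun i a => a + F i e) 0)); last first.
  move=> e; elim: (n e) => [|m IH]; first by rewrite big_geq.
  by rewrite iteriS IH big_nat_recr.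
apply: computable_iteri => //; first exact: computable_const.
apply: computable_add; first exact: computable_var.
exact: (computable_reindex (fun i => if i is j.+1 then j.+2 else 0) HF).
Qed.

Lemma computable_expn f g : computable f -> computable g -> computable (fun e => f e ^ g e).
Proof.
move=> Hf Hg.
have H : computable (fun e => e 0 ^ e 1).
  apply: (computable_ext (f := fun e => iteri (e 1) (fun _ a => a * e 0) 1)).
    apply: (@computable_iteri (fun e => e 1) (fun=> 1) (fun _ a e => a * e 0)).
    - exact: computable_var.
    - exact: computable_const.
    - by apply: computable_mul; apply: computable_var.
  by move=> e; elim: (e 1) => //= n ->; rewrite expnSr.
exact: (computable_compose2 H).
Qed.

(** Counting the multiples of [d] up to [m]. *)
Lemma iteri_divn m d : 0 < d ->
  iteri m (fun _ q => if q.+1 * d <= m then q + 1 else q) 0 = m %/ d.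
Proof.
move=> d0; suff H n : iteri n (fun _ q => if q.+1 * d <= m then q + 1 else q) 0 = minn n (m %/ d).
  by rewrite H (minn_idPr _) ?leq_div.
by elim: n => [|n IH] /=; rewrite ?min0n // IH -leq_divRL //; case: ifP; lia.
Qed.

Lemma computable_divn f g : computable f -> computable g -> computable (fun e => f e %/ g e).
Proof.
move=> Hf Hg.
have H : computable (fun e => e 0 %/ e 1).
  apply: (computable_ext (f := fun e =>
    if 0 < e 1 then iteri (e 0) (fun _ q => if (q + 1) * e 1 <= e 0 then q + 1 else q) 0 else 0)).
    apply: computable_if; last exact: computable_const.
      by apply: computable_ltn; [apply: computable_const|apply: computable_var].
    apply: (@computable_iteri (fun e => e 0) (fun=> 0)
      (fun _ q e => if (q + 1) * e 1 <= e 0 then q + 1 else q)).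
    - exact: computable_var.
    - exact: computable_const.
    - apply: computable_if; last exact: computable_var.
        apply: computable_leq; last exact: computable_var.
        apply: computable_mul; last exact: computable_var.
        by apply: computable_add; [apply: computable_var|apply: computable_const].
      by apply: computable_add; [apply: computable_var|apply: computable_const].
  move=> e; case: (posnP (e 1)) => [->|e1]; first by rewrite divn0.
  rewrite -iteri_divn //; congr iteri.
  by do 2!apply: functional_extensionality => ?; rewrite addn1.
exact: (computable_compose2 H).
Qed.

Lemma computable_modn f g : computable f -> computable g -> computable (fun e => f e %% g e).
Proof.
move=> Hf Hg; apply: (computable_ext (f := fun e => f e - f e %/ g e * g e)).
  by apply: computable_sub => //; apply: computable_mul => //; apply: computable_divn.
by move=> e; rewrite {1}(divn_eq (f e) (g e)) addKn.
Qed.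

Lemma computable_odd f : computable f -> computable (fun e => odd (f e)).
Proof.
move=> Hf; apply: (computable_ext (f := fun e => f e %% 2)).
  by apply: computable_modn => //; apply: computable_const.
by move=> e; rewrite modn2.
Qed.

(** The form in which the main program uses a subroutine: its arguments are
the registers in the list [l]. *)
(** * Dynamic programming on a stack of tables *)

Lemma computable_call f l : computable f -> l != [::] -> all (fun y => y < 30) l ->
  exists p T, forall b W (s : state) (Q : state -> Prop),
    all (fun y => s.1 y <= b) l -> T b <= W ->
    (forall s', s'.1 30 = f (fun i => s.1 (nth (head 0 l) l i)) ->
       (forall y, y < 30 -> s'.1 y = s.1 y) -> s'.2 = s.2 -> Q s') ->
    wp W (T b) p Q s.
Proof.
move=> Hf l0 Hl.
have Hnth (P : pred nat) : all P l -> forall i, P (nth (head 0 l) l i).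
  case: l l0 Hl => // x l _ _ Hall i.
  have [lt|ge] := ltnP i (size (x :: l)); first exact: (all_nthP _ Hall).
  by rewrite nth_default //=; case/andP: Hall.
have [p [T E]] := Hf 30 (fun i => nth (head 0 l) l i) (Hnth _ Hl).
by exists p, T => b W s Q Hb; apply: E => i; apply: (Hnth (fun y => s.1 y <= b)).
Qed.

Section Machine.

(** Registers below [rQ] hold the state of the main loop, which ends when
[rLeft] is 0; the others below [rOut] are scratch space of its parts, and those
from [rOut] on belong to the subroutines, which leave their result in [rOut].  The registers [cQ], [cQ1]
and [cQ2] count down the loops over [rQ], [rQ1] and [rQ2]. *)
Local Notation rLen := 0 (only parsing).
Local Notation rPos := 1 (only parsing).
Local Notation rTop := 2 (only parsing).
Local Notation rK := 3 (only parsing).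
Local Notation rWidth := 4 (only parsing).
Local Notation rOp := 5 (only parsing).
Local Notation rI := 6 (only parsing).
Local Notation rJ := 7 (only parsing).
Local Notation rQ := 8 (only parsing).
Local Notation rQ1 := 9 (only parsing).
Local Notation rQ2 := 10 (only parsing).
Local Notation cQ := 11 (only parsing).
Local Notation cQ1 := 12 (only parsing).
Local Notation cQ2 := 13 (only parsing).
Local Notation rAcc := 14 (only parsing).
Local Notation rGuard := 15 (only parsing).
Local Notation rX := 16 (only parsing).
Local Notation rY := 17 (only parsing).
Local Notation rAddr := 18 (only parsing).
Local Notation rTmp := 19 (only parsing).
Local Notation rLeft := 20 (only parsing).
Local Notation rFlag := 21 (only parsing).
Local Notation zFor := 22 (only parsing).
Local Notation zIf := 23 (only parsing).
Local Notation rOut := 30 (only parsing).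

Variables (width : nat -> nat) (init : nat -> nat -> nat -> nat -> nat).
Variables (trans : nat -> nat -> nat -> nat -> nat -> nat -> nat).
Variable (final : nat -> nat -> nat).
Hypothesis init_le2 : forall k o i q, init k o i q <= 2.

(** A table entry is 0 for an impossible state and otherwise one more than a
weight; hence the sum of two entries counts the 1 twice. *)
Definition combine_step k o i j (X Y : nat -> nat) q q1 q2 a :=
  if [&& trans k o i j q1 q2 == q, 0 < X q1 & 0 < Y q2]
  then maxn a (X q1 + Y q2).-1 else a.

Definition combine k o i j (X Y : nat -> nat) q :=
  iteri (width k) (fun q1 a =>
    iteri (width k) (fun q2 a => combine_step k o i j X Y q q1 q2 a) a) 0.

Definition op : Type := (nat * nat * nat)%type.

(** Opcodes: 0 vertex, 1 union, 2 join, 3 relabelling. *)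
Definition op_code (c : op) := let: (o, x, y) := c in
  if o == 1 then [:: 1] else [:: o; x; y].

(** All operations but the union push a table, and all but the vertex then
combine the two tables on top: a unary operation is a binary one whose second
argument is a fixed table.  The minimum with [k] does not affect labels; it
keeps the arguments of subroutines bounded in terms of [k] when the words
read as labels are not labels, as after the opcode of a union. *)
Definition run_op k (st : seq (nat -> nat)) (c : op) : option (seq (nat -> nat)) :=
  let: (o, x, y) := c in
  let st1 := if o != 1 then init k o (minn k x) :: st else st in
  if o != 0 then
    if st1 is Y :: X :: st' then Some (combine k o (minn k x) (minn k y) X Y :: st')
    else None
  else Some st1.

Fixpoint run_ops k st cs :=
  if cs is c :: cs' then obind (fun st' => run_ops k st' cs') (run_op k st c) else Some st.

Definition best k (T : nat -> nat) :=
  iteri (width k) (fun q a =>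
    if (0 < T q) && (0 < final k q) then maxn a (T q + final k q - 2) else a) 0.

Hypothesis width_comp : computable (fun e => width (e 0)).
Hypothesis init_comp : computable (fun e => init (e 0) (e 1) (e 2) (e 3)).
Hypothesis trans_comp :
  computable (fun e => trans (e 0) (e 1) (e 2) (e 3) (e 4) (e 5) == e 6).
Hypothesis final_comp : computable (fun e => final (e 0) (e 1)).

(** The stack of tables occupies the memory from address [L] on, the length
of the input, its last table being at the lowest addresses. *)
Fixpoint stored (M : nat -> nat) L B (st : seq (nat -> nat)) : Prop :=
  if st is T :: st' then
    (forall q, q < B -> M (L + size st' * B + q) = T q) /\ stored M L B st'
  else True.

Lemma stored_frame M M' L B st :
  (forall a, a < L + size st * B -> M' a = M a) -> stored M L B st -> stored M' L B st.
Proof.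
elim: st => //= T st IH H [HT Hst]; split.
  by move=> q qB; rewrite H ?HT // mulSn; lia.
by apply: IH => // a Ha; apply: H; rewrite mulSn; lia.
Qed.

(** Upper bounds for the entries of the tables, of total at most [S].
Combining two tables does not increase the total and pushing a table adds 2 to
it; this is why the words of the machine grow only linearly. *)
Fixpoint weighed B S (st : seq (nat -> nat)) : Prop :=
  if st is T :: st' then
    exists2 m, m <= S & (forall q, q < B -> T q <= m) /\ weighed B (S - m) st'
  else True.

Lemma weighed_mono B S S' st : S <= S' -> weighed B S st -> weighed B S' st.
Proof.
elim: st S S' => //= T st IH S S' le [m mS [Hm Hw]]; exists m; first lia.
by split=> //; apply: IH Hw; lia.
Qed.

Definition push_prog p :=
  Seq (For rQ cQ zFor rWidth (Seq p (Line [:: Plus rAddr rTop rQ; Write rAddr rOut])))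
      (Line [:: Plus rTop rTop rWidth]).

Lemma push_spec : exists p t, forall b W (s : state) (Q : state -> Prop) k o i B top,
  s.1 rTop = top -> s.1 rK = k -> s.1 rWidth = B -> s.1 rOp = o -> s.1 rI = i ->
  k <= b -> o <= b -> i <= b -> B <= b -> t b <= W -> top + B < W ->
  (forall s', s'.1 rTop = top + B -> (forall y, y < 8 -> y != rTop -> s'.1 y = s.1 y) ->
    (forall q, q < B -> s'.2 (top + q) = init k o i q) ->
    (forall a, a < top -> s'.2 a = s.2 a) -> Q s') ->
  wp W (t b) p Q s.
Proof.
have [//|//|p [T E]] := @computable_call _ [:: rK; rOp; rI; rQ] init_comp.
exists (push_prog p), (fun b => b * (T b + 2 + 4) + 7 + T b).
move=> b W s Q k o i B top s2 s3 s4 s5 s6 kb ob ib Bb tW topW HQ.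
pose Inv m (s' : state) := [/\ forall y, y < 8 -> s'.1 y = s.1 y,
  forall q, q < m -> s'.2 (top + q) = init k o i q & forall a, a < top -> s'.2 a = s.2 a].
have le : B * (T b + 2 + 4) + 6 + 1 <= b * (T b + 2 + 4) + 7 + T b.
  by have := leq_mul Bb (leqnn (T b + 2 + 4)); lia.
apply: wp_mono le (fun _ _ => id) _; apply: wp_seq.
apply: (@wp_for _ _ _ _ _ _ _ _ Inv) => //.
- lia.
- move=> m s0 s1 mem low [H1 H2 H3]; split=> [y y8|q qm|a atop].
  + by rewrite low ?H1 // !inE; lia.
  + by rewrite -mem H2.
  + by rewrite -mem H3.
- move=> m s1 mB s8 [H1 H2 H3]; apply: wp_seq; apply: E => [||s' d' low' mem'].
  + by rewrite /= (H1 3) ?(H1 5) ?(H1 6) // s3 s5 s6 s8 kb ob ib; lia.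
  + lia.
  + move: d'; rewrite /= (H1 3) ?(H1 5) ?(H1 6) // s3 s5 s6 s8 => d'.
    apply: wp_line_le => //=; rewrite !low' // (H1 2) // s2 s8.
    split; first lia; split=> //; rewrite /update /=; split; [|by rewrite ?low'|by rewrite low'].
    split=> /= [y y8|q qm|a atop].
    * by case: eqP => [?|_]; [lia|rewrite low' ?H1; lia].
    * case: eqP => [e|ne]; first by rewrite d'; congr init; lia.
      by rewrite mem' H2 //; lia.
    * by case: eqP => [e|ne]; [lia|rewrite mem' H3].
- move=> s1 [H1 H2 H3]; apply: wp_line_le => //=; rewrite !H1 // s2 s4; split; first lia.
  apply: HQ => //= y y8 y2.
  by rewrite /update (negPf y2) H1.
Qed.

Lemma wp_assume_bounded W t p Q s : (bounded W s -> wp W t p Q s) -> wp W t p Q s.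
Proof. by move=> H B; apply: H. Qed.

Definition cell_prog p :=
  Seq p (Seq (Line [:: Minus rAddr rTop rWidth; Plus rTmp rAddr rQ2; Read rY rTmp;
    Minus rAddr rAddr rWidth; Plus rTmp rAddr rQ1; Read rX rTmp;
    Const rTmp 1; Minus rFlag rTmp rX; Minus rFlag rOut rFlag; Minus rTmp rTmp rY; Minus rFlag rFlag rTmp])
  (If rFlag zIf (Line [:: Plus rX rX rY; Const rTmp 1; Minus rX rX rTmp;
    Minus rX rX rAcc; Plus rAcc rAcc rX]))).

(** One pair of states [q1], [q2] of the tables [X] at [bot] and [Y] on top of
it.  The flag is computed from truncated differences [1 - n], each of which is
the truth value of [n = 0]. *)
Lemma cell_spec : exists p t, forall b W (s : state) (Q : state -> Prop) k o i j q1 q2 q B bot X Y,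
  s.1 rK = k -> s.1 rOp = o -> s.1 rI = i -> s.1 rJ = j ->
  s.1 rQ1 = q1 -> s.1 rQ2 = q2 -> s.1 rQ = q -> s.1 rWidth = B -> s.1 rTop = bot + B + B ->
  k <= b -> o <= b -> i <= b -> j <= b -> q1 <= b -> q2 <= b -> q <= b ->
  t b <= W -> 0 < W -> bot + B + q2 <= W -> bot + q1 <= W ->
  s.2 (bot + B + q2) = Y -> s.2 (bot + q1) = X -> X + Y <= W ->
  (forall s', (forall y, y < 14 -> s'.1 y = s.1 y) -> s'.2 = s.2 ->
    s'.1 rAcc = (if [&& trans k o i j q1 q2 == q, 0 < X & 0 < Y]
               then maxn (s.1 rAcc) (X + Y).-1 else s.1 rAcc) -> Q s') ->
  wp W (t b) p Q s.
Proof.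
have [//|//|p [T E]] := @computable_call _ [:: rK; rOp; rI; rJ; rQ1; rQ2; rQ] trans_comp.
exists (cell_prog p), (fun b => T b + (11 + (5 + 5))).
move=> b W s Q k o i j q1 q2 q B bot X Y s3 s5 s6 s7 s9 s10 s8 s4 s2.
move=> kb ob ib jb q1b q2b qb tW W0 W1 W2 EY EX XYW HQ.
apply: wp_assume_bounded => bs.
apply: wp_seq; apply: E => [||s1 d1 low1 mem1].
- by rewrite /= s3 s5 s6 s7 s8 s9 s10 kb ob ib jb q1b q2b qb.
- lia.
move: d1; rewrite /= s3 s5 s6 s7 s8 s9 s10 => d1.
apply: wp_seq; apply: wp_line_le => //=; rewrite /update /=.
rewrite d1 !low1 // s9 s10 s4 s2 mem1.
have -> : bot + B + B - B = bot + B by lia.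
have -> : bot + B - B = bot by lia.
rewrite EX EY.
do 11 (split => //).
apply: wp_if => //= [f0|f1]; rewrite /update /=.
  apply: HQ => /= [y y14||]; rewrite ?mem1 //.
    by rewrite !ltn_eqF ?low1 //; lia.
  rewrite low1 //; case: ifP => // /and3P[/eqP e X0 Y0].
  by move: f0; rewrite /update /= e eqxx; lia.
have /and3P[e X0 Y0] : [&& trans k o i j q1 q2 == q, 0 < X & 0 < Y].
  by move: f1; rewrite /update /=; case: (_ == _) => /=; lia.
have s14 := (bs 14).1.
apply: wp_line_le => //=; rewrite /update /= !low1 //; split=> //; split=> //.
split=> //; split=> //; split; first lia.
apply: HQ => //= [y y14|]; last by rewrite e X0 Y0 /=; lia.
by rewrite !ltn_eqF ?low1 //; lia.
Qed.

(** The result is built above the two arguments and then copied over the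
first of them. *)
Definition combine_prog p :=
  Seq (For rQ cQ zFor rWidth
        (Seq (Line [:: Const rAcc 0])
          (Seq (For rQ1 cQ1 zFor rWidth (For rQ2 cQ2 zFor rWidth p)) (Line [:: Plus rAddr rTop rQ; Write rAddr rAcc]))))
  (Seq (Line [:: Minus rTop rTop rWidth])
       (For rQ cQ zFor rWidth (Line [:: Plus rAddr rTop rQ; Plus rAddr rAddr rWidth; Read rX rAddr;
                                Minus rAddr rTop rWidth; Plus rAddr rAddr rQ; Write rAddr rX]))).

Lemma combine_spec : exists p t, forall b W (s : state) (Q : state -> Prop) k o i j bot X Y,
  let B := width k in
  s.1 rK = k -> s.1 rOp = o -> s.1 rI = i -> s.1 rJ = j ->
  s.1 rWidth = B -> s.1 rTop = bot + B + B ->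
  k <= b -> o <= b -> i <= b -> j <= b -> B <= b ->
  t b <= W -> bot + B + B + B < W ->
  (forall q, q < B -> s.2 (bot + q) = X q) ->
  (forall q, q < B -> s.2 (bot + B + q) = Y q) ->
  (forall q1 q2, q1 < B -> q2 < B -> X q1 + Y q2 <= W) ->
  (forall s', s'.1 rTop = bot + B -> (forall y, y < 8 -> y != rTop -> s'.1 y = s.1 y) ->
    (forall q, q < B -> s'.2 (bot + q) = combine k o i j X Y q) ->
    (forall a, a < bot -> s'.2 a = s.2 a) -> Q s') ->
  wp W (t b) p Q s.
Proof.
have [p [T E]] := cell_spec.
pose T1 b := b * (T b + 4) + 6.
pose T2 b := b * (T1 b + 4) + 6.
pose T3 b := b * (1 + (T2 b + 2) + 4) + 6.
exists (combine_prog p), (fun b => T3 b + (1 + (b * (6 + 4) + 6)) + T b).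
move=> b W s Q k o i j bot X Y B s3 s5 s6 s7 s4 s2 kb ob ib jb Bb tW topW EX EY XYW HQ.
have mulB x : B * x <= b * x by rewrite leq_mul2r Bb orbT.
have W0 : 0 < W by lia.
apply: (@wp_le _ (T3 b + (1 + (b * (6 + 4) + 6)))); first lia.
apply: wp_seq.
pose top := bot + B + B.
pose Inv m (s' : state) := [/\ forall y, y < 8 -> s'.1 y = s.1 y,
  forall q, q < m -> s'.2 (top + q) = combine k o i j X Y q &
  forall a, a < top -> s'.2 a = s.2 a].
apply: (@wp_le _ (B * (1 + (T2 b + 2) + 4) + 6)); [by rewrite /T3 leq_add2r|].
apply: (@wp_for _ _ _ _ _ _ _ _ Inv) => //.
- lia.
- move=> m u1 u2 mem low [H1 H2 H3]; split=> [y y8|q qm|a atop].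
  + by rewrite low ?H1 // !inE; lia.
  + by rewrite -mem H2.
  + by rewrite -mem H3.
- move=> q u qB u8 [H1 H2 H3].
  apply: wp_seq; apply: wp_line_le => //=; split=> //.
  set u0 : state := (update u.1 14 0, u.2).
  have lowu y : y < 14 -> u0.1 y = u.1 y by move=> y14; rewrite /= /update ltn_eqF.
  apply: wp_seq.
  pose Inv1 m (s' : state) := [/\ forall y, y < 12 -> y \notin [:: 9; 10] -> s'.1 y = u.1 y, s'.2 = u.2 &
    s'.1 14 = iteri m (fun q1 a => iteri B (fun q2 a => combine_step k o i j X Y q q1 q2 a) a) 0].
  apply: (@wp_le _ (B * (T1 b + 4) + 6)); [by rewrite /T2 leq_add2r|].
  apply: (@wp_for _ _ _ _ _ _ _ _ Inv1) => //.
  + by rewrite lowu // H1.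
  + lia.
  + move=> m u1 u2 mem low [I1 I2 I3]; split=> [y y12 y9||].
    * move: (y9); rewrite !inE => ?; rewrite low ?I1 // !inE; lia.
    * by rewrite -mem I2.
    * by rewrite low.
  + by split=> // y y12 _; apply: lowu; lia.
  + move=> q1 v q1B v9 [I1 I2 I3].
    pose Inv2 m (s' : state) := [/\ forall y, y < 13 -> y != 10 -> s'.1 y = v.1 y, s'.2 = v.2 &
      s'.1 14 = iteri m (fun q2 a => combine_step k o i j X Y q q1 q2 a) (v.1 14)].
    apply: (@wp_le _ (B * (T b + 4) + 6)); [by rewrite /T1 leq_add2r|].
    apply: (@wp_for _ _ _ _ _ _ _ _ Inv2) => //.
    * by rewrite I1 ?H1.
    * lia.
    * move=> m u1 u2 mem low [J1 J2 J3]; split=> [y y13 y10||].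
      - by rewrite low ?J1 // !inE; lia.
      - by rewrite -mem J2.
      - by rewrite low.
    * move=> q2 w q2B w10 [J1 J2 J3].
      have low y : y < 12 -> y != 9 -> y != 10 -> w.1 y = u.1 y.
        by move=> *; rewrite J1 ?I1 // ?inE; lia.
      have low8 y : y < 8 -> w.1 y = s.1 y by move=> y8; rewrite low ?H1 //; lia.
      apply: (E b W w _ k o i j q1 q2 q B bot (X q1) (Y q2)).
      - by rewrite low8.
      - by rewrite low8.
      - by rewrite low8.
      - by rewrite low8.
      - by rewrite J1.
      - by [].
      - by rewrite low.
      - by rewrite low8.
      - by rewrite low8.
      - by [].
      - by [].
      - by [].
      - by [].
      - by lia.
      - by lia.
      - by lia.
      - by lia.
      - by lia.
      - by lia.
      - by lia.
      - by rewrite J2 I2 H3 ?EY // /top; lia.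
      - by rewrite J2 I2 H3 ?EX // /top; lia.
      - exact: XYW.
      - move=> w' loww memw accw; split; [split=> [y y13 y10||]| |].
        + by rewrite loww ?J1 //; lia.
        + by rewrite memw.
        + by rewrite accw iteriS -J3.
        + by rewrite loww.
        + by rewrite loww.
    * move=> w [J1 J2 J3]; split; [split=> [y y12 y9||]| |].
      - by move: (y9); rewrite !inE => ?; rewrite J1 ?I1 //; lia.
      - by rewrite J2.
      - by rewrite J3 I3 iteriS.
      - by rewrite J1.
      - by rewrite J1.
  move=> v [I1 I2 I3]; apply: wp_line_le => //=; rewrite /update /=.
  rewrite (I1 2) // (I1 8) // H1 // s2 u8; split; first lia; split=> //.
  split; [|by []|by rewrite I1].
  split=> /= [y y8|q' q'm|a atop].
  + by rewrite ltn_eqF ?I1 ?H1 // ?inE; lia.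
  + case: eqP => [e|ne]; last by rewrite I2 H2 //; rewrite /top; lia.
    have -> : q' = q by lia.
    exact: I3.
  + by case: eqP => [e|ne]; [rewrite /top in atop; lia|rewrite I2 H3].
- move=> v [H1 H2 H3].
  apply: wp_seq; apply: wp_line_le => //=; split=> //.
  rewrite H1 // H1 // s2 s4 addnK.
  set v0 : state := (update v.1 2 (bot + B), v.2).
  have low0 y : y < 8 -> y != 2 -> v0.1 y = s.1 y.
    by move=> y8 /negPf y2; rewrite /= /update y2 H1.
  pose Inv' m (s' : state) := [/\ forall y, y < 8 -> s'.1 y = v0.1 y,
    forall q, q < m -> s'.2 (bot + q) = combine k o i j X Y q,
    forall q, q < B -> s'.2 (top + q) = combine k o i j X Y q &
    forall a, a < bot -> s'.2 a = s.2 a].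
  apply: (@wp_le _ (B * (6 + 4) + 6)); first by rewrite leq_add2r.
  apply: (@wp_for _ _ _ _ _ _ _ _ Inv') => //.
  + by rewrite low0.
  + lia.
  + move=> m u1 u2 mem low [I1 I2 I3 I4]; split=> [y y8|q qm|q qB|a atop].
    * by rewrite low ?I1 // !inE; lia.
    * by rewrite -mem I2.
    * by rewrite -mem I3.
    * by rewrite -mem I4.
  + by split=> // a atop; apply: H3; rewrite /top; lia.
  + move=> q u qB u8 [I1 I2 I3 I4].
    apply: wp_line_le => //=; rewrite /update /=.
    have -> : u.1 2 = bot + B by rewrite I1.
    have -> : u.1 4 = B by rewrite I1 // low0.
    rewrite u8; have -> : bot + B + q + B = top + q by rewrite /top; lia.
    rewrite addnK I3 //; do 3! (split; first by rewrite ?/top; lia).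
    split=> //; split; first lia; split=> //.
    split=> //; split=> /= [y y8|q' q'm|q' q'B|a atop].
    * by rewrite !ltn_eqF ?I1 //; lia.
    * by case: eqP => [e|ne]; [congr combine; lia|rewrite I2 //; lia].
    * by case: eqP => [e|ne]; [rewrite /top in e; lia|rewrite I3].
    * by case: eqP => [e|ne]; [lia|rewrite I4].
  + move=> u [I1 I2 I3 I4]; apply: HQ => //; first by rewrite I1.
    by move=> y y8 y2; rewrite I1 // low0.
Qed.


Lemma combine_le k o i j X Y m :
  (forall q1 q2, q1 < width k -> q2 < width k -> X q1 + Y q2 <= m) ->
  forall q, combine k o i j X Y q <= m.
Proof.
move=> XYm q; rewrite /combine.
have H n1 : n1 <= width k -> iteri n1 (fun q1 a =>
    iteri (width k) (fun q2 a => combine_step k o i j X Y q q1 q2 a) a) 0 <= m.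
  elim: n1 => //= n1 IH lt1; have := IH (ltnW lt1).
  move: (iteri _ _ 0) => a0 a0m.
  have H n2 : n2 <= width k -> iteri n2 (fun q2 a => combine_step k o i j X Y q n1 q2 a) a0 <= m.
    elim: n2 => //= n2 IH2 lt2; have := IH2 (ltnW lt2); rewrite /combine_step.
    by case: ifP => // _; have := XYm _ _ lt1 lt2; lia.
  exact: H.
exact: H.
Qed.

(** A union has no labels, but the registers for labels hold arbitrary words. *)
Hypothesis trans1 : forall k i j i' j' q1 q2, trans k 1 i j q1 q2 = trans k 1 i' j' q1 q2.

Lemma combine1 k i j i' j' X Y : combine k 1 i j X Y = combine k 1 i' j' X Y.
Proof.
have E : trans k 1 i j = trans k 1 i' j'.
  by do 2!apply: functional_extensionality => ?; apply: trans1.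
by rewrite /combine /combine_step E.
Qed.

Definition ops_code cs := flatten (map op_code cs).

(** The state between two operations: [cs] is the rest of the code, [n] the
number of operations done. *)
Definition ready k inp st n cs (s : state) :=
  let L := size inp in
  [/\ [/\ s.1 rLen = L, s.1 rK = k, s.1 rWidth = width k & s.1 rTop = L + size st * width k],
      [/\ s.1 rPos + size (ops_code cs) = L & drop (s.1 rPos) inp = ops_code cs],
      forall a, a < L -> s.2 a = nth 0 inp a,
      stored s.2 L (width k) st /\ weighed (width k) (2 * n) st & size st <= n].

Definition Guard pc p :=
  Seq pc (Seq (Line [:: Const rGuard 0; Plus rGuard rGuard rOut]) (If rGuard zIf p)).

Lemma guard_spec (c : nat -> bool) : computable (fun e => c (e 0)) ->
  exists pc T, forall b W t (s : state) (Q : state -> Prop) p, s.1 rOp <= b -> T b < W ->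
  (forall s', (forall y, y < 30 -> y != rGuard -> y != zIf -> s'.1 y = s.1 y) -> s'.2 = s.2 ->
     if c (s.1 rOp) then wp W t p (fun s2 => Q (update s2.1 rGuard 0, s2.2)) s' else Q s') ->
  wp W (T b + (2 + (t + 5))) (Guard pc p) Q s.
Proof.
move=> Hc; have [//|//|pc [T E]] := @computable_call _ [:: rOp] Hc.
exists pc, T => b W t s Q p s5 TW HQ.
apply: wp_seq; apply: E => [||u u30 low mem]; [by rewrite /= s5|lia|].
rewrite /= in u30.
apply: wp_seq; apply: wp_line_le => //=; split=> //.
rewrite /update /= u30; split; first by case: (c _) => /=; lia.
set w : state := (_, _).
have w15 : w.1 15 = c (s.1 5) by [].
have := HQ (update w.1 23 1, w.2) _ mem.
have low' y : y < 30 -> y != 15 -> y != 23 -> (update w.1 23 1, w.2).1 y = s.1 y.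
  by move=> y30 /negPf y15 /negPf y23; rewrite /= /update y23 y15 low.
move=> /(_ low') HW; apply: wp_if => //; first lia; rewrite w15.
  by move: HW; case: (c _).
by move: HW; case: (c _).
Qed.

Definition body_prog pu me p1 p0 pa :=
  Seq (Line [:: Read rOp rPos; Const rTmp 1; Plus rAddr rPos rTmp; Read rX rAddr; Minus rI rK rX; Minus rI rK rI;
                Plus rAddr rAddr rTmp; Read rX rAddr; Minus rJ rK rX; Minus rJ rK rJ])
  (Seq (Guard p1 pu) (Seq (Guard p0 me)
  (Seq pa (Line [:: Plus rPos rPos rOut; Minus rLeft rLen rPos])))).

(** The state while the operation [o] with arguments [i] and [j], read at
[pos], is carried out. *)
Definition mid k inp st S o i j pos (s : state) :=
  let L := size inp in
  [/\ [/\ s.1 rLen = L, s.1 rK = k, s.1 rWidth = width k & s.1 rTop = L + size st * width k],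
      [/\ s.1 rPos = pos, s.1 rOp = o, s.1 rI = i & s.1 rJ = j],
      forall a, a < L -> s.2 a = nth 0 inp a,
      stored s.2 L (width k) st & weighed (width k) S st].

Lemma mid_frame k inp st S o i j pos (s s' : state) :
  (forall y, y < 8 -> s'.1 y = s.1 y) -> s'.2 = s.2 ->
  mid k inp st S o i j pos s -> mid k inp st S o i j pos s'.
Proof.
move=> low mem [[s0 s3 s4 s2] [s1 s5 s6 s7] inpE Hst Hw].
by split; rewrite ?mem //; split; rewrite low.
Qed.

(** The time depends on [k] only, through the bound [b] on the arguments of
subroutines.  The words need room for the stack, which has at most [n] tables,
and for a few tables of scratch space. *)
Lemma body_spec : exists p t, forall W (s : state) k inp st st' n o x y cs,
  let b := k + width k + 3 in
  ready k inp st n ((o, x, y) :: cs) s -> run_op k st (o, x, y) = Some st' -> o <= 3 ->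
  t b <= W -> size inp + (n + 4) * width k + 2 * n + 10 <= W ->
  wp W (t b) p (fun s' => ready k inp st' n.+1 cs s' /\ s'.1 rLeft = size inp - s'.1 rPos) s.
Proof.
have [pu [Tu Eu]] := push_spec; have [me [Tm Em]] := combine_spec.
have ne_comp c : computable (fun e => e 0 != c).
  by apply/computable_negb/computable_eq; [apply: computable_var|apply: computable_const].
have adv_comp : computable (fun e => if e 0 == 1 then 1 else 3).
  apply: computable_if; last exact: computable_const; last exact: computable_const.
  by apply/computable_eq; [apply: computable_var|apply: computable_const].
have [p1 [T1 E1]] := guard_spec (c := fun o => o != 1) (ne_comp 1).
have [p0 [T0 E0]] := guard_spec (c := fun o => o != 0) (ne_comp 0).
have [//|//|pa [Ta Ea]] := @computable_call _ [:: rOp] adv_comp.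
exists (body_prog pu me p1 p0 pa).
exists (fun b => 10 + ((T1 b + (2 + (Tu b + 5))) + ((T0 b + (2 + (Tm b + 5))) + (Ta b + 2)))).
move=> W s k inp st st' n o x y cs b [[s0 s3 s4 s2] [s1 code] inpE [Hst Hw] szst] run o3 tW HW.
set L := size inp in s0 s2 s1 inpE Hst HW *; set B := width k in s4 s2 Hst Hw HW *.
set pos := s.1 1 in s1 code *.
have szB : size st * B <= n * B by rewrite leq_mul2r szst orbT.
have inpnth a : nth 0 inp (pos + a) = nth 0 (ops_code ((o, x, y) :: cs)) a.
  by rewrite -code nth_drop.
have sz1 : 0 < size (op_code (o, x, y)) <= 3 by rewrite /=; case: ifP.
have szc : size (ops_code ((o, x, y) :: cs)) = size (op_code (o, x, y)) + size (ops_code cs).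
  by rewrite /ops_code /= size_cat.
have code' : drop (pos + size (op_code (o, x, y))) inp = ops_code cs.
  by rewrite addnC -drop_drop code /ops_code map_cons [flatten _]/= drop_size_cat.
have Mo : s.2 pos = o.
  rewrite inpE; last lia.
  by rewrite -(addn0 pos) inpnth /ops_code /=; case: eqP.
(* The two words after a union are not its labels: [i] and [j] are arbitrary
   then, but still at most [k]. *)
pose i := minn k (s.2 (pos + 1)); pose j := minn k (s.2 (pos + 2)).
have Mij : o != 1 -> i = minn k x /\ j = minn k y.
  move=> o1; have sz3 : size (op_code (o, x, y)) = 3 by rewrite /= (negPf o1).
  by rewrite /i /j !inpE ?inpnth /ops_code /= ?(negPf o1) //; lia.
have lei : i <= k by apply: geq_minl.
have lej : j <= k by apply: geq_minl.
apply: wp_seq; apply: wp_line_le => //=; rewrite /update /= -/pos; split=> //; split; first lia.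
split; first lia; split=> //; split=> //; split=> //; split; first lia.
do 3! split=> //.
set u := (_, _).
have u_mid : mid k inp st (2 * n) o i j pos u.
  split=> //; split=> //=; rewrite ?s3; first by rewrite /i; lia.
  by rewrite /j (_ : pos + 1 + 1 = pos + 2); lia.
move: u u_mid => u u_mid.
have frame (v w : state) st1 S : (forall y, y < 8 -> w.1 y = v.1 y) -> w.2 = v.2 ->
    mid k inp st1 S o i j pos v -> mid k inp st1 S o i j pos w.
  exact: mid_frame.
pose st1 := if o != 1 then init k o i :: st else st.
have st1E : st1 = if o != 1 then init k o (minn k x) :: st else st.
  by rewrite /st1; case: ifP => // /Mij[-> _].
have szst1 : size st1 <= n.+1 by rewrite /st1; case: ifP => _ /=; lia.
have szB1 : size st1 * B <= n.+1 * B by rewrite leq_mul2r szst1 orbT.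
rewrite mulSn in szB1; rewrite mulnDl in HW.
apply: wp_seq; apply: E1.
- by case: u_mid => _ [_ -> _ _] _ _ _ /=; lia.
- lia.
move=> v low mem; have u5 : u.1 5 = o by case: u_mid => _ [].
have v_mid : mid k inp st (2 * n) o i j pos v by apply: frame u_mid => // y0 y8; apply: low; lia.
rewrite u5; clear dependent u.
suff H (w : state) : mid k inp st1 (2 * n + 2) o i j pos w ->
    wp W (T0 b + (2 + (Tm b + 5)) + (Ta b + 2))
      (Seq (Guard p0 me) (Seq pa (Line [:: Plus rPos rPos rOut; Minus rLeft rLen rPos])))
      (fun s' => ready k inp st' n.+1 cs s' /\ s'.1 20 = L - s'.1 1) w.
  case: (v_mid) => [[v0 v3 v4 v2] [v1 v5 v6 v7] vinp vst vw].
  rewrite /st1 in H; case: ifP H => o1 H; last first.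
    by apply: H; case: v_mid => *; split=> //; apply: weighed_mono vw; lia.
  apply: (Eu b W v _ k o i B _ v2 v3 v4 v5 v6); [lia|lia|lia|lia|lia|lia|].
  move=> w w2 wlow winit wmem; apply: H; apply: (@frame w) => // [y0 y8|].
    by rewrite /= /update ltn_eqF //; lia.
  split.
  - by rewrite (wlow 0) ?(wlow 3) ?(wlow 4) //; split=> //; rewrite w2 /= mulSn -/B; lia.
  - by rewrite !wlow.
  - by move=> a aL; rewrite wmem ?vinp //; lia.
  - by split; [move=> q qB; rewrite winit|apply: stored_frame vst => a Ha; apply: wmem].
  - by exists 2; [lia|split=> [q _|]; [apply: init_le2|rewrite addnK]].
move=> w_mid; case: (w_mid) => [[w0 w3 w4 w2] [w1 w5 w6 w7] winp wst ww].
have [sz szE] : exists sz, sz = size (op_code (o, x, y)) by eexists.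
rewrite -szE in szc sz1 code'.
have Hfin st2 (v' : state) : mid k inp st2 (2 * n.+1) o i j pos v' -> size st2 <= n.+1 ->
    wp W (Ta b + 2) (Seq pa (Line [:: Plus rPos rPos rOut; Minus rLeft rLen rPos]))
      (fun s' => ready k inp st2 n.+1 cs s' /\ s'.1 20 = L - s'.1 1) v'.
  move=> [[r0 r3 r4 r2] [r1 r5 r6 r7] rinp rst rw] rsz.
  apply: wp_seq; apply: Ea => [||z z30 zlow zmem]; [rewrite /= r5; lia|lia|].
  rewrite /= r5 in z30.
  have z30' : z.1 30 = sz by rewrite z30 szE /=; case: eqP.
  apply: wp_line_le => //=; rewrite /update /=; rewrite zlow // r1 z30'.
  split; first lia; split=> //; rewrite zlow // r0; split=> //.
  split=> //=.
  - by rewrite !zlow.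
  - by split; [rewrite -/L; lia|].
  - by move=> a aL; rewrite zmem rinp.
  - by rewrite zmem.
apply: wp_seq; apply: E0 => [||z zlow zmem]; [rewrite w5; lia|lia|].
have z_mid : mid k inp st1 (2 * n + 2) o i j pos z.
  by apply: (frame w) => // y0 y8; apply: zlow; lia.
rewrite w5; move: run; rewrite /run_op -st1E; case: ifP => o0; last first.
  case=> <-; apply: Hfin => //; case: z_mid => *; split=> //; apply: (@weighed_mono _ (2 * n + 2)) => //; lia.
case: (z_mid) => [[z0 z3 z4 z2] [z1 z5 z6 z7] zinp].
move: szst1 szB1; case: (st1) z2 => [|Y [|X st2]] //= z2 szst1 szB1 [EY [EX zst]].
case=> m2 m2le [HY [m1 m1le [HX zw]]] [<-].
rewrite -/B -/L in EX EY zst HY HX zw *.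
pose bot := L + size st2 * B.
rewrite !mulSn in z2 szB1 EY.
have XYle q1 q2 : q1 < B -> q2 < B -> X q1 + Y q2 <= m1 + m2.
  by move=> q1B q2B; apply: leq_add; [apply: HX|apply: HY].
apply: (Em b W z _ k o i j bot X Y z3 z5 z6 z7 z4) => //; rewrite -/B.
- by rewrite z2 -/L -/B /bot; lia.
- lia.
- lia.
- lia.
- lia.
- lia.
- lia.
- by rewrite /bot; lia.
- by move=> q qB; rewrite -EY // /bot; congr (z.2 _); lia.
- by move=> q1 q2 q1B q2B; have := XYle _ _ q1B q2B; lia.
move=> r r2 rlow rcombine rmem; apply: Hfin => /=; last lia.
apply: (@frame r) => // [y0 y8|]; first by rewrite /= /update ltn_eqF //; lia.
have -> : combine k o (minn k x) (minn k y) X Y = combine k o i j X Y.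
  have [->|/Mij[-> ->] //] := eqVneq o 1; exact: combine1.
split=> /=.
- by rewrite (rlow 0) ?(rlow 3) ?(rlow 4) //; split=> //; rewrite r2 /bot mulSn -/B -/L; lia.
- by rewrite !rlow.
- by move=> a aL; rewrite rmem ?zinp // /bot -/L; lia.
- split; first by rewrite -/B -/L.
  by apply: stored_frame zst => a Ha; apply: rmem.
- exists (m1 + m2); first lia.
  split=> [q _|]; first exact: combine_le.
  by apply: weighed_mono zw; lia.
Qed.

Definition final_prog pf :=
  Seq (Line [:: Const rAcc 0]) (Seq
  (For rQ cQ zFor rWidth (Seq pf (Seq
    (Line [:: Plus rAddr rLen rQ; Read rX rAddr; Const rTmp 1; Minus rFlag rTmp rX; Minus rY rTmp rOut;
              Minus rFlag rTmp rFlag; Minus rFlag rFlag rY])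
    (If rFlag zIf (Line [:: Plus rX rX rOut; Const rTmp 2; Minus rX rX rTmp;
                        Minus rX rX rAcc; Plus rAcc rAcc rX])))))
  (Line [:: Const rTmp 1; Read rX rTmp; Plus rAcc rAcc rTmp; Minus rLen rAcc rX])).

Lemma best_le k T m : (forall q, q < width k -> T q + final k q <= m) -> best k T <= m.
Proof.
move=> Tm; rewrite /best; have : width k <= width k by [].
elim: {1 3}(width k) => //= n IH lt; have {IH} := IH (ltnW lt).
by case: ifP => // _; have := Tm _ lt; lia.
Qed.

Lemma final_spec : exists p t, forall b W (s : state) (Q : state -> Prop) k r L T,
  s.1 rLen = L -> s.1 rK = k -> s.1 rWidth = width k -> s.2 1 = r ->
  (forall q, q < width k -> s.2 (L + q) = T q) ->
  (forall q, q < width k -> T q + final k q < W) ->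
  k <= b -> width k <= b -> t b <= W -> L + width k < W ->
  (forall s', s'.1 rLen = best k T + 1 - r -> Q s') ->
  wp W (t b) p Q s.
Proof.
have [//|//|p [Tf E]] := @computable_call _ [:: rK; rQ] final_comp.
exists (final_prog p), (fun b => 1 + ((b * ((Tf b + (7 + 10)) + 4) + 6) + 4) + Tf b).
move=> b W s Q k r L T s0 s3 s4 Mr MT TW kb Bb tW LW HQ.
have W2 : 2 < W by lia.
have bestW : best k T < W.
  have : best k T <= W.-1 by apply: best_le => q /TW; lia.
  by lia.
apply: wp_le (leq_addr _ _) _.
apply: wp_seq; apply: wp_line_le => //=; split=> //.
pose step q a := if (0 < T q) && (0 < final k q) then maxn a (T q + final k q - 2) else a.
pose Inv m (s' : state) := [/\ forall y, y < 8 -> s'.1 y = s.1 y, s'.2 = s.2 &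
  s'.1 14 = iteri m step 0].
apply: wp_seq.
apply: (@wp_le _ (width k * ((Tf b + (7 + 10)) + 4) + 6)).
  by rewrite leq_add2r leq_mul2r Bb orbT.
apply: (@wp_for _ _ _ _ _ _ _ _ Inv) => //.
- by lia.
- move=> m s1 s2 mem low [H1 H2 H3]; split=> [y y8||].
  + by rewrite low ?H1 // !inE; lia.
  + by rewrite -mem H2.
  + by rewrite low.
- by split=> // y y8; rewrite /= /update ltn_eqF //; lia.
- move=> q u qB u8 [H1 H2 H3]; apply: wp_seq; apply: E => [||v v30 low mem].
  + by rewrite /= (H1 3) // s3 u8 kb; lia.
  + lia.
  move: v30; rewrite /= (H1 3) // s3 u8 => v30.
  have Tq := MT _ qB; have TWq := TW _ qB.
  apply: wp_assume_bounded => vb.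
  apply: wp_seq; apply: wp_line_le => //=; rewrite /update /= v30 (low 0) // (low 8) // (H1 0) // s0 u8.
  rewrite mem H2 Tq; split; first lia; do 6!(split=> //; try lia).
  apply: (@wp_if _ 5) => //=; first lia.
  + rewrite /update /= => f0; split=> /=; [|by rewrite low|by rewrite low].
    split=> /= [y y8||].
    * by rewrite !ltn_eqF ?low ?H1 //; lia.
    * by rewrite ?mem.
    * rewrite low // -H3 /step; case: ifP => // /andP[]; lia.
  + rewrite /update /= => f1.
    have s14 := (vb 14).1.
    apply: wp_line_le => //=; rewrite /update /= v30 (low 14) //.
    rewrite (low 14) // in s14.
    split; first lia; do 3!(split=> //; try lia).
    split; [lia|split=> /=; [|by rewrite ?low|by rewrite ?low]].
    split=> /= [y y8||].
    * by rewrite !ltn_eqF ?low ?H1 //; lia.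
    * by rewrite ?mem.
    * rewrite -H3 /step; case: ifP => [_|/andP[]]; lia.
- move=> u [H1 H2 H3]; apply: wp_line_le => //=; rewrite /update /= H2 Mr H3.
  have -> : iteri (width k) step 0 = best k T by [].
  split; first lia; split=> //; split; first lia; split=> //.
  exact: HQ.
Qed.

Definition main_prog pw pb pf :=
  Seq (Line [:: Const rTmp 0; Read rK rTmp]) (Seq pw (Seq
  (Line [:: Const rWidth 0; Plus rWidth rWidth rOut; Const rPos 2; Const rTop 0; Plus rTop rTop rLen; Minus rLeft rLen rPos])
  (Seq (While rLeft zFor pb) pf))).

Lemma size_ops_code cs : size cs <= size (ops_code cs) <= 3 * size cs.
Proof.
elim: cs => //= [[[o x] y] cs IH]; rewrite /ops_code /= size_cat.
by case: eqP => _ /=; move: IH; rewrite /ops_code; lia.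
Qed.

(** A program that leaves its code stays where it is, so that the bounds up to
that moment hold forever. *)
Lemma decides_wp W t p x (b : bool) :
  (forall i, nth 0 x i <= W) -> size x <= W ->
  wp W t p (fun s => (0 < s.1 rLen) = b) (update (fun=> 0) 0 (size x), nth 0 x) ->
  decides_within (compile p) x b t W.
Proof.
move=> xW sxW H; have [|s' [u [ut Hb Hr]]] := H.
  by move=> i; split=> //=; rewrite /update; case: ifP.
have [E B] := Hr _ _ (@placed_self _).
have halt v : run (compile p) (u + v) (initial x) = Config (size (compile p)) s'.1 s'.2.
  rewrite runD /initial E add0n.
  elim: v => // v IH; rewrite /run iterS [iter v _ _]IH /step /=.
  by rewrite onth_default.
split.
- by rewrite -(subnKC ut) halt.
- by rewrite -(subnKC ut) halt.
- move=> v i; have [vu|uv] := leqP v u; first exact: (B v vu i).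
  rewrite -(subnKC (ltnW uv)) halt.
  by have := B u (leqnn u) i; rewrite E.
Qed.

(** The assumptions on [cs] hold for the code of an expression whose size is
at most [N]; the machine evaluates it in reverse Polish notation. *)
Theorem run_program : exists P f, forall k r cs T N,
  run_ops k [::] cs = Some [:: T] -> all (fun c : op => c.1.1 <= 3) cs ->
  size cs <= N -> 0 < N ->
  all (fun v => v <= k + r + 3 * N) (ops_code cs) ->
  decides_within P (k :: r :: ops_code cs) (r <= best k T) (f k * N) (f k * (N + r)).
Proof.
have [//|//|pw [tw Ew]] := @computable_call _ [:: rK] width_comp.
have [pb [tb Eb]] := body_spec; have [pf [tf Ef]] := final_spec.
pose Vf k := \max_(q < width k) final k q.
pose b k := k + width k + 3.
exists (compile (main_prog pw pb pf)).
exists (fun k => tw k + tb (b k) + tf (b k) + Vf k + 6 * width k + k + 40).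
move=> k r cs T N runT o3 szN N0 codeN.
set f := _ + 40; set W := f * (N + r).
have fN c : c <= c * N by apply: leq_pmulr.
have WN : (tw k + tb (b k) + tf (b k) + Vf k + 6 * width k + k + 40) * N + r <= W.
  by rewrite /W mulnDr leq_add2l; apply: leq_pmull; rewrite /f addnS.
rewrite !mulnDl in WN.
have := (fN (tw k), fN (tb (b k)), fN (tf (b k)), fN (Vf k), fN k) => -[[[[fw fb] ff] fV] fk].
set inp := k :: r :: ops_code cs.
have szinp : size inp = (size (ops_code cs)).+2 by [].
have /andP[_ szc] := size_ops_code cs.
apply: decides_wp.
- move=> i; case: (ltnP i (size inp)) => [lt|ge]; last by rewrite nth_default.
  case: i lt => [|[|i]] /= lt; [lia|lia|].
  have lt' : i < size (ops_code cs) by [].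
  by apply: leq_trans ((all_nthP 0 codeN) i lt') _; lia.
- by rewrite szinp; lia.
have time : 2 + (tw k + (6 + ((size cs * (tb (b k)).+1 + 3) + tf (b k)))) <= f * N.
  have := leq_mul szN (leqnn (tb (b k)).+1); rewrite mulnS => H.
  by rewrite /f !mulnDl; lia.
apply: wp_le time _.
set s0 : state := (_, _).
apply: wp_seq; apply: wp_line_le => //=; do 2!split=> //; rewrite /update /=.
apply: wp_seq; apply: Ew => [||u u30 low mem]; [by rewrite /= leqnn|lia|].
rewrite /= in u30.
apply: wp_seq; apply: wp_line_le => //=; rewrite /update /= u30 (low 0) //=.
have widthW : width k <= W by have := fN (width k); lia.
split=> //; split=> //; split; first lia; split=> //; split; first lia; split=> //.
set v : state := (_, _).
have v_ready : ready k inp [::] 0 cs v.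
  split=> //=.
  - by split; rewrite ?low ?u30 ?szinp //= ?mul0n ?addn0.
  - by rewrite drop0.
  - by rewrite mem.
have v20 : v.1 20 = size inp - v.1 1 by [].
apply: wp_seq; move: v v_ready v20 => {u low mem u30} v v_ready v20.
pose Inv m (s : state) := exists st n cs', [/\ size cs' = m, n + m = size cs,
  ready k inp st n cs' s /\ s.1 20 = size inp - s.1 1, run_ops k st cs' = Some [:: T] &
  all (fun c : op => c.1.1 <= 3) cs'].
apply: (@wp_while _ _ _ _ _ _ Inv).
- move=> m s [st [n [[|[[o x] y] cs'] []]]] // [szm] nm [srd s20] srun sall0.
  have so : o <= 3 by case/andP: sall0.
  have [_ [spos _] _ _ _] := srd.
  have posc : 0 < size (ops_code ((o, x, y) :: cs')).
    by have /andP[+ _] := size_ops_code ((o, x, y) :: cs'); apply: leq_trans.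
  split; first by rewrite s20 -spos addKn.
  have [st' E srun'] : exists2 st', run_op k st (o, x, y) = Some st' &
      run_ops k st' cs' = Some [:: T].
    by move: srun; rewrite /run_ops -/run_ops; case: run_op => // st' ?; exists st'.
  have nB : (n + 4) * width k <= 5 * width k * N.
    have -> : 5 * width k * N = (5 * N) * width k by lia.
    by rewrite leq_mul2r; apply/orP; right; lia.
  apply: wp_mono (Eb W s k inp st st' n o x y cs' srd E so _ _) => //.
  + move=> s' _ [rd' s20']; exists st', n.+1, cs'; split=> //; [lia|by case/andP: sall0].
  + rewrite -/(b k); lia.
  + by rewrite szinp; lia.
- move=> s [st [n [[|? ?] []]]] // _ nm [[[r0 r3 r4 _] [rpos _] rinp [rst rw] _] s20] [stE] _.
  split; first by rewrite s20; move: rpos; rewrite /ops_code /=; lia.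
  subst st; case: rst => rT _; case: rw => m2 m2le [rTle _].
  rewrite /= addn0 in rT.
  apply: (Ef (b k) W s _ k r (size inp) T) => //.
  + by rewrite rinp.
  + move=> q qB; have Vq : final k q <= Vf k by apply: (leq_bigmax (Ordinal qB)).
    by have := rTle _ qB; lia.
  + by rewrite /b; lia.
  + by rewrite /b; lia.
  + lia.
  + by have := fN (width k); rewrite szinp; lia.
  + by move=> s' ->; apply/idP/idP; lia.
- lia.
- by exists [::], 0, cs.
Qed.

End Machine.

(** * Facts and the operations of an expression *)

(** The first argument is the kind of the fact, the other four are labels or
letters; [facts_of] below gives the meaning of the four kinds. *)
Definition fact : Type := nat -> nat -> nat -> nat -> nat -> bool.

(** Both the labels, below [k], and the nine letters are digits. *)
Definition radix k := k + 9.
Definition nfacts k := 4 * radix k ^ 4.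
Definition width k := 2 ^ nfacts k.

Definition fact_code k t x y z w :=
  (((t * radix k + x) * radix k + y) * radix k + z) * radix k + w.

Definition holds k q : fact := fun t x y z w => odd (q %/ 2 ^ fact_code k t x y z w).

(** The number whose bit at [fact_code k t x y z w] is the truth value of the
fact; the five arguments are the digits of [b]. *)
Definition encode k (P : fact) :=
  \sum_(0 <= b < nfacts k)
    (P (b %/ radix k %/ radix k %/ radix k %/ radix k)
       (b %/ radix k %/ radix k %/ radix k %% radix k)
       (b %/ radix k %/ radix k %% radix k)
       (b %/ radix k %% radix k) (b %% radix k) : nat) * 2 ^ b.

(** A single vertex has a letter and no neighbours. *)
Definition leaf_fact i p : fact := fun t x y z w => (t <= 1) && (x == i) && (y == p).

(** The only new facts are pairs of letters 6 and 7 in different components,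
which are not adjacent so far. *)
Definition union_fact (P Q : fact) : fact := fun t x y z w =>
  P t x y z w || Q t x y z w ||
  (t == 3) && (P 0 x 6 0 0 && Q 0 y 7 0 0 || Q 0 x 6 0 0 && P 0 y 7 0 0).

(** A vertex with label [i] now sees all letters that occur with label [j],
and conversely; pairs with these two labels become adjacent. *)
Definition join_fact i j (P : fact) : fact := fun t x y z w =>
  if t == 0 then P 0 x y z w
  else if t == 1 then
    P 1 x y z w && ~~ ((x == i) && (P 0 j z 0 0 || P 0 j w 0 0))
                && ~~ ((x == j) && (P 0 i z 0 0 || P 0 i w 0 0))
  else if t == 2 then
    P 2 x y z w || (P 0 i x 0 0 && P 0 j y 0 0) || (P 0 j x 0 0 && P 0 i y 0 0)
  else P 3 x y z w && ~~ ((x == i) && (y == j)) && ~~ ((x == j) && (y == i)).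

(** A vertex with label [j] is one that had label [j] or [i]. *)
Definition relabel_fact i j (P : fact) : fact := fun t x y z w =>
  if t <= 1 then (x != i) && P t x y z w || (x == j) && P t i y z w
  else if t == 2 then P 2 x y z w
  else ((x != i) && ((y != i) && P 3 x y z w || (y == j) && P 3 x i z w)) ||
       ((x == j) && ((y != i) && P 3 i y z w || (y == j) && P 3 i i z w)).

Definition step_fact o i j (P Q : fact) : fact := fun t x y z w =>
  if o == 1 then union_fact P Q t x y z w
  else if o == 2 then join_fact i j P t x y z w
  else relabel_fact i j P t x y z w.

Definition trans k o i j q1 q2 := encode k (step_fact o i j (holds k q1) (holds k q2)).

(** For a vertex, the maximal number of letters 7, plus one, over the letters
that produce the state [q]; for a unary operation, the table in which only
the state 0 is possible, with weight 0. *)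
Definition init k o i q :=
  if o == 0 then
    if encode k (leaf_fact i 7) == q then 2
    else if all (fun p => encode k (leaf_fact i p) != q) (iota 0 9) then 0 else 1
  else q == 0.

Definition present k (P : fact) p := ~~ all (fun a => ~~ P 0 a p 0 0) (iota 0 k).

Definition dominates k (P : fact) p q :=
  all (fun a => all (fun x => ~~ P 1 a x p q) (iota 0 9)) (iota 0 k).

Definition covers (P : fact) p q :=
  all (fun x => all (fun y =>
    ~~ P 2 x y 0 0 || ((x == p) || (x == q)) || ((y == p) || (y == q)))
    (iota 0 9)) (iota 0 9).

Definition toids_fact k (P : fact) p q := dominates k P p q && covers P p q.

(** The classes of the letters below 6 form a coalition partition. *)
Definition coloring_ok k (P : fact) :=
  all (fun p => ~~ present k P p || (p < 6)) (iota 0 9) &&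
  all (fun p => ~~ present k P p ||
    ~~ all (fun q => ~~ ((q != p) && present k P q &&
       (~~ toids_fact k P p p && ~~ toids_fact k P q q && toids_fact k P p q))) (iota 0 6)) (iota 0 6).

(** The letters describe a set [N] of independent vertices, with letter 7: those
with letter 6 have neighbourhood [N], and those with letter 8 have a neighbour
with letter 8, hence one outside [N]. *)
Definition star_ok k (P : fact) :=
  all (fun p => ~~ present k P p || (6 <= p)) (iota 0 9) &&
  (present k P 6 && present k P 7 &&
   (~~ P 2 6 6 0 0 && ~~ P 2 6 8 0 0 && ~~ P 2 7 7 0 0) &&
   all (fun a => ~~ P 1 a 8 8 8) (iota 0 k) &&
   all (fun a => all (fun b => ~~ P 3 a b 0 0) (iota 0 k)) (iota 0 k)).

(** One more than the number of parts of the partition that the weight does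
not count, and 0 for an annotation without meaning. *)
Definition bonus k (P : fact) :=
  if coloring_ok k P then \sum_(0 <= p < 6) present k P p + 1
  else if star_ok k P then 2 else 0.

Definition final k q := bonus k (holds k q).

(** * Subroutines for the transitions *)

Lemma computable_ifb (c d f : (nat -> nat) -> bool) :
  computable (fun e => c e) -> computable (fun e => d e) -> computable (fun e => f e) ->
  computable (fun e => if c e then d e else f e).
Proof.
move=> Hc Hd Hf; apply: (computable_ext (f := fun e => if c e then nat_of_bool (d e) else f e)).
  exact: computable_if.
by move=> e; case: (c e).
Qed.

(** Closure properties are selected by the head of the function; unification
with the wrong one would unfold arithmetic. *)
Ltac comp1 := cbv beta; lazymatch goal with
  | |- computable (fun e => nat_of_bool (negb (@?c e))) => apply: computable_negb
  | |- computable (fun e => nat_of_bool (andb (@?c e) (@?d e))) => apply: computable_andb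
  | |- computable (fun e => nat_of_bool (orb (@?c e) (@?d e))) => apply: computable_orb
  | |- computable (fun e => nat_of_bool (leq (@?c e) (@?d e))) => apply: computable_leq
  | |- computable (fun e => nat_of_bool (eq_op (@?c e) (@?d e))) => apply: computable_eq
  | |- computable (fun e => nat_of_bool (odd (@?c e))) => apply: computable_odd
  | |- computable (fun e => nat_of_bool (all (@?c e) (@?d e))) => apply: computable_all
  | |- computable (fun e => S (@?c e)) => apply: computable_succ
  | |- computable (fun e => addn (@?c e) (@?d e)) => apply: computable_add
  | |- computable (fun e => muln (@?c e) (@?d e)) => apply: computable_mul
  | |- computable (fun e => expn (@?c e) (@?d e)) => apply: computable_expn
  | |- computable (fun e => divn (@?c e) (@?d e)) => apply: computable_divn
  | |- computable (fun e => modn (@?c e) (@?d e)) => apply: computable_modn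
  | |- computable (fun e => e _) => apply: computable_var
  | |- computable (fun _ => ?c) => apply: computable_const
  | |- _ => first [assumption | apply: computable_ifb | apply: computable_if | apply: computable_sum]
  end.

Lemma computable_holds k q t x y z w :
  computable k -> computable q -> computable t -> computable x -> computable y ->
  computable z -> computable w ->
  computable (fun e => holds (k e) (q e) (t e) (x e) (y e) (z e) (w e)).
Proof. move=> *; rewrite /holds /fact_code /radix; repeat comp1. Qed.

Ltac solve_comp := repeat (cbv beta; lazymatch goal with
  | |- computable (fun e => nat_of_bool
        (holds (@?k e) (@?q e) (@?t e) (@?x e) (@?y e) (@?z e) (@?w e))) =>
      apply: computable_holds
  | |- _ => comp1
  end).


Lemma width_computable : computable (fun e => width (e 0)).
Proof. by rewrite /width /nfacts /radix; solve_comp. Qed.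

Lemma init_computable : computable (fun e => init (e 0) (e 1) (e 2) (e 3)).
Proof.
rewrite /init /encode /leaf_fact /nfacts /radix.
by solve_comp.
Qed.

Lemma trans_computable :
  computable (fun e => trans (e 0) (e 1) (e 2) (e 3) (e 4) (e 5) == e 6).
Proof.
rewrite /trans /encode /step_fact /union_fact /join_fact /relabel_fact /nfacts /radix.
by solve_comp.
Qed.

Lemma final_computable : computable (fun e => final (e 0) (e 1)).
Proof.
rewrite /final /bonus /coloring_ok /star_ok /toids_fact /dominates /covers /present.
by solve_comp.
Qed.

Lemma trans1 k i j i' j' q1 q2 : trans k 1 i j q1 q2 = trans k 1 i' j' q1 q2.
Proof. by []. Qed.

Lemma init_le2 k o i q : init k o i q <= 2.
Proof. by rewrite /init; case: (o == 0); [case: (_ == q) => //; case: (all _ _)|case: (q == 0)]. Qed.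

(** * Sets of facts as numbers *)

Lemma sum_bits_lt F (c : nat -> bool) : \sum_(0 <= b < F) c b * 2 ^ b < 2 ^ F.
Proof.
elim: F => [|F IH]; first by rewrite big_geq.
by rewrite big_nat_recr //= expnS; case: (c F); lia.
Qed.

Lemma odd_sum_bits F (c : nat -> bool) a : a < F ->
  odd ((\sum_(0 <= b < F) c b * 2 ^ b) %/ 2 ^ a) = c a.
Proof.
elim: F => // F IH; rewrite ltnS leq_eqVlt big_nat_recr //=.
have p0 n : 0 < 2 ^ n by rewrite expn_gt0.
case/orP => [/eqP ->|lt]; first by rewrite divnDMl // divn_small ?sum_bits_lt //; case: (c F).
have -> : 2 ^ F = 2 ^ (F - a).-1 * 2 * 2 ^ a by rewrite -expnSr -expnD; congr (_ ^ _); lia.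
by rewrite !mulnA divnDMl // oddD !oddM !andbF addbF; apply: IH.
Qed.

Lemma radix_gt k : 8 < radix k. Proof. by rewrite /radix; lia. Qed.

Lemma fact_code_lt k t x y z w :
  t < 4 -> x < radix k -> y < radix k -> z < radix k -> w < radix k ->
  fact_code k t x y z w < nfacts k.
Proof.
rewrite /fact_code /nfacts; move: (radix k) => R *.
have step a b c : a < c -> b < R -> a * R + b < c * R by nia.
have -> : 4 * R ^ 4 = 4 * R * R * R * R by rewrite !expnS expn0; lia.
by do 4!apply: (step) => //.
Qed.

Lemma holds_encode k P t x y z w :
  t < 4 -> x < radix k -> y < radix k -> z < radix k -> w < radix k ->
  holds k (encode k P) t x y z w = P t x y z w.
Proof.
move=> t4 xR yR zR wR; rewrite /holds /encode.
pose c b := P (b %/ radix k %/ radix k %/ radix k %/ radix k)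
  (b %/ radix k %/ radix k %/ radix k %% radix k)
  (b %/ radix k %/ radix k %% radix k) (b %/ radix k %% radix k) (b %% radix k).
rewrite (odd_sum_bits c) /c; last exact: fact_code_lt.
have R0 : 0 < radix k by have := radix_gt k; lia.
have quot a b : b < radix k -> (a * radix k + b) %/ radix k = a.
  by move=> bR; rewrite divnMDl // divn_small ?addn0.
have rem a b : b < radix k -> (a * radix k + b) %% radix k = b.
  by move=> bR; rewrite modnMDl modn_small.
by rewrite /fact_code !quot // !rem.
Qed.

(** Only the facts that have a code matter. *)
Definition same_facts k (P Q : fact) := forall t x y z w,
  t < 4 -> x < radix k -> y < radix k -> z < radix k -> w < radix k ->
  P t x y z w = Q t x y z w.

Lemma encode_ext k P Q : same_facts k P Q -> encode k P = encode k Q.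
Proof.
move=> PQ; apply: eq_big_nat => b bF; congr (nat_of_bool _ * _).
have R0 : 0 < radix k by have := radix_gt k; lia.
apply: PQ; rewrite ?ltn_mod // !ltn_divLR // -!mulnA.
by move: bF; rewrite /nfacts !expnS expn0 muln1 andTb.
Qed.

Lemma encode_lt k P : encode k P < width k.
Proof. exact: sum_bits_lt. Qed.

Lemma same_holds_encode k P : same_facts k (holds k (encode k P)) P.
Proof. by move=> t x y z w *; apply: holds_encode. Qed.

Lemma step_fact_ext k o i j P Q P' Q' : i < radix k -> j < radix k ->
  same_facts k P P' -> same_facts k Q Q' ->
  same_facts k (step_fact o i j P Q) (step_fact o i j P' Q').
Proof.
move=> iR jR PP QQ t x y z w t4 xR yR zR wR; have R8 := radix_gt k.
have R0 : 0 < radix k by lia.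
have [R6 R7] : 6 < radix k /\ 7 < radix k by lia.
rewrite /step_fact /union_fact /join_fact /relabel_fact.
by rewrite !PP ?QQ.
Qed.

Lemma trans_encode k o i j P Q : i < radix k -> j < radix k ->
  trans k o i j (encode k P) (encode k Q) = encode k (step_fact o i j P Q).
Proof.
by move=> iR jR; apply/encode_ext/step_fact_ext => //; apply: same_holds_encode.
Qed.

Lemma bonus_ext k P Q : same_facts k P Q -> bonus k P = bonus k Q.
Proof.
move=> PQ; have R8 := radix_gt k.
have R a : a < 9 -> a < radix k by lia.
have Rk a : a \in iota 0 k -> a < radix k by rewrite mem_iota /radix; lia.
have R9 a n : n <= 9 -> a \in iota 0 n -> a < radix k by rewrite mem_iota; lia.
have pres p : p < 9 -> present k P p = present k Q p.
  move=> p9; rewrite /present; congr (~~ _); apply: eq_in_all => a /Rk ak.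
  by rewrite PQ //; apply: R.
have gd p q : p < 9 -> q < 9 -> toids_fact k P p q = toids_fact k Q p q.
  move=> p9 q9; congr (_ && _).
    by apply: eq_in_all => a /Rk ak; apply: eq_in_all => x /(R9 _ 9 isT) xk; rewrite PQ //; apply: R.
  by apply: eq_in_all => x /(R9 _ 9 isT) xk; apply: eq_in_all => y /(R9 _ 9 isT) yk; rewrite PQ //; apply: R.
have lt a n : n <= 9 -> a \in iota 0 n -> a < 9 by rewrite mem_iota; lia.
rewrite /bonus; have -> : coloring_ok k P = coloring_ok k Q.
  congr (_ && _); apply: eq_in_all => p; first by move=> /(lt _ 9 isT) p9; rewrite pres.
  move=> /(lt _ 6 isT) p9;  rewrite pres //; congr (_ || ~~ _); apply: eq_in_all => q /(lt _ 6 isT) q9.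
  by rewrite pres // !gd.
have -> : star_ok k P = star_ok k Q.
  congr (_ && _); first by apply: eq_in_all => p /(lt _ 9 isT) p9; rewrite pres.
  rewrite !pres // !PQ //; do ?[exact: R]; congr (_ && _ && _).
    by apply: eq_in_all => a /Rk ak; rewrite PQ //; apply: R.
  by apply: eq_in_all => a /Rk ak; apply: eq_in_all => b /Rk bk; rewrite PQ //; apply: R.
case: ifP => // _; congr (_ + _).
by apply: eq_big_nat => p p6; rewrite pres //; lia.
Qed.

Lemma final_encode k P : final k (encode k P) = bonus k P.
Proof. exact/bonus_ext/same_holds_encode. Qed.

(** * Facts about an annotated expression *)

Section Semantics.
Variables (V : finType) (k : nat).
Implicit Types (e : kexpr V k) (alpha : V -> nat).

(** Labels as numbers: facts speak of arbitrary numbers. *)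
Definition has_label e v (a : nat) :=
  if kexpr_label e v is Some i then i == a :> nat else false.

Lemma has_labelE e v (i : 'I_k) : has_label e v i = (kexpr_label e v == Some i).
Proof. by rewrite /has_label; case: kexpr_label => [j|] //=. Qed.

(** The kinds 0 and 2 ignore the remaining arguments.  Kind 1 is about vertices
that still lack a neighbour, kind 3 about pairs that are still to be joined. *)
Definition facts_of e alpha : fact := fun t x y z w =>
  match t with
  | 0 => [exists v, has_label e v x && (alpha v == y)]
  | 1 => [exists v, (has_label e v x && (alpha v == y)) &&
            [forall u, kexpr_edge e v u ==> (alpha u != z) && (alpha u != w)]]
  | 2 => [exists v, exists u, [&& kexpr_edge e v u, alpha v == x & alpha u == y]]
  | _ => [exists v, exists u, [&& has_label e v x, alpha v == 6, has_label e u y, alpha u == 7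
            & ~~ kexpr_edge e v u]]
  end.

Lemma label_vertices e v : (kexpr_label e v : bool) = (v \in kexpr_vertices e).
Proof.
elim: e => [i u|e1 IH1 e2 IH2|i j e IH|i j e IH] //=.
- by rewrite inE; case: eqP.
- by rewrite inE -IH1 -IH2; case: kexpr_label.
- by rewrite -IH; case: eqP => // ->.
Qed.

Lemma has_label_vertices e v a : has_label e v a -> v \in kexpr_vertices e.
Proof. by rewrite /has_label -label_vertices; case: kexpr_label. Qed.

Lemma kexpr_edge_sym e : symmetric (kexpr_edge e).
Proof.
elim: e => [i u|e1 IH1 e2 IH2|i j e IH|i j e IH] //= x y; first by rewrite IH1 IH2.
by rewrite IH; case: (kexpr_edge e y x) => //=; do 4!case: (_ == _).
Qed.

Lemma edge_vertices e u v : kexpr_edge e u v ->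
  (u \in kexpr_vertices e) && (v \in kexpr_vertices e).
Proof.
elim: e => [i w|e1 IH1 e2 IH2|i j e IH|i j e IH] //=.
- by rewrite !inE => /orP[/IH1|/IH2] /andP[-> ->]; rewrite ?orbT.
- by case/or3P=> [/IH //| |] /andP[/eqP Hu /eqP Hv]; rewrite -!label_vertices Hu Hv.
Qed.

Lemma facts_vertex (i : 'I_k) v alpha : same_facts k (facts_of (Vertex i v) alpha) (leaf_fact i (alpha v)).
Proof.
move=> [|[|[|[|t]]]] x y z w //= _ _ _ _ _; rewrite /leaf_fact /=.
- apply/existsP/andP => [[u]|[/eqP -> /eqP ->]].
    by rewrite /has_label /=; case: eqP => // -> /andP[/eqP -> /eqP ->].
  by exists v; rewrite /has_label /= !eqxx.
- apply/existsP/andP => [[u]|[/eqP -> /eqP ->]].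
    by rewrite /has_label /=; case: eqP => // -> /andP[/andP[/eqP -> /eqP ->]].
  by exists v; rewrite /has_label /= !eqxx /=; apply/forallP.
- by apply/existsP => -[u /existsP[]].
- apply/existsP => -[u /existsP[u' /and5P[Hu /eqP au Hu' /eqP au' _]]].
  move: Hu Hu' au au'; rewrite /has_label /=; case: eqP => // -> _; case: eqP => // -> _ -> //.
Qed.

Lemma has_label_union e1 e2 v a : [disjoint kexpr_vertices e1 & kexpr_vertices e2] ->
  has_label (Union e1 e2) v a = has_label e1 v a || has_label e2 v a.
Proof.
move=> dis; rewrite /has_label /=; have := disjointFr dis (x := v).
rewrite -!label_vertices; case: (kexpr_label e1 v) => //= i /(_ isT).
by case: (kexpr_label e2 v) => // _; rewrite orbF.
Qed.

(** No edge runs between the two components. *)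
Lemma facts_union e1 e2 alpha : [disjoint kexpr_vertices e1 & kexpr_vertices e2] ->
  same_facts k (facts_of (Union e1 e2) alpha) (union_fact (facts_of e1 alpha) (facts_of e2 alpha)).
Proof.
move=> dis; have lab := has_label_union _ _ dis.
have dis1 v : v \in kexpr_vertices e1 -> v \in kexpr_vertices e2 -> False.
  by move=> v1; rewrite (disjointFr dis v1).
have bad1 v u : v \in kexpr_vertices e1 -> kexpr_edge e2 v u = false.
  by move=> v1; apply/negP => /edge_vertices/andP[v2 _]; apply: (dis1 v).
have bad2 v u : v \in kexpr_vertices e2 -> kexpr_edge e1 v u = false.
  by move=> v2; apply/negP => /edge_vertices/andP[v1 _]; apply: (dis1 v).
move=> [|[|[|[|t]]]] x y z w // _ _ _ _ _; rewrite /union_fact ?orbF [RHS]/=.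
- apply/existsP/orP => [[v]|[]/existsP[v /andP[lv av]]].
  + by rewrite lab => /andP[/orP[] lv av]; [left|right]; apply/existsP; exists v; rewrite lv.
  + by exists v; rewrite lab lv.
  + by exists v; rewrite lab lv orbT.
- rewrite ?orbF; apply/existsP/orP => [[v]|[]/existsP[v /andP[/andP[lv av] /forallP Hf]]].
  + rewrite lab => /andP[/andP[/orP[] lv av] /forallP Hf]; [left|right]; apply/existsP; exists v;
      rewrite lv av; apply/forallP => u; have := Hf u; rewrite /=.
      by case: (kexpr_edge e1 v u).
    by case: (kexpr_edge e2 v u); rewrite ?orbT.
  + exists v; rewrite lab lv av; apply/forallP => u /=.
    by rewrite (bad1 _ _ (has_label_vertices lv)) orbF.
  + exists v; rewrite lab lv av orbT; apply/forallP => u /=.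
    by rewrite (bad2 _ _ (has_label_vertices lv)) orFb; apply: Hf.
- rewrite [LHS]/=; apply/existsP/orP => [[v /existsP[u /and3P[/= /orP[] E av au]]]|[]/existsP[v /existsP[u /and3P[E av au]]]].
  + by left; apply/existsP; exists v; apply/existsP; exists u; rewrite E av.
  + by right; apply/existsP; exists v; apply/existsP; exists u; rewrite E av.
  + by exists v; apply/existsP; exists u; rewrite /= E av.
  + by exists v; apply/existsP; exists u; rewrite /= E av orbT.
- apply/existsP/idP => [[v /existsP[u /and5P[]]]|].
    rewrite !lab /= negb_or => /orP[] lv av /orP[] lu au /andP[E1 E2].
    + apply/orP; left; apply/orP; left; apply/existsP; exists v; apply/existsP; exists u.
      by rewrite lv av lu au.
    + apply/orP; right; apply/orP; left; apply/andP; split; apply/existsP.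
        by exists v; rewrite lv.
      by exists u; rewrite lu.
    + apply/orP; right; apply/orP; right; apply/andP; split; apply/existsP.
        by exists v; rewrite lv.
      by exists u; rewrite lu.
    + apply/orP; left; apply/orP; right; apply/existsP; exists v; apply/existsP; exists u.
      by rewrite lv av lu au.
  case/orP=> [/orP[]|/orP[]].
  + case/existsP=> v /existsP[u /and5P[lv av lu au E]]; exists v; apply/existsP; exists u.
    by rewrite !lab lv av lu au /= (negPf E) (bad1 _ _ (has_label_vertices lv)).
  + case/existsP=> v /existsP[u /and5P[lv av lu au E]]; exists v; apply/existsP; exists u.
    by rewrite !lab lv av lu au /= (negPf E) (bad2 _ _ (has_label_vertices lv)) !orbT.
  + case/andP=> /existsP[v /andP[lv av]] /existsP[u /andP[lu au]].
    exists v; apply/existsP; exists u; rewrite !lab lv av lu au /= (bad1 _ _ (has_label_vertices lv)).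
    by rewrite kexpr_edge_sym (bad2 _ _ (has_label_vertices lu)) orbT.
  + case/andP=> /existsP[v /andP[lv av]] /existsP[u /andP[lu au]].
    exists v; apply/existsP; exists u; rewrite !lab lv av lu au /= (bad2 _ _ (has_label_vertices lv)).
    by rewrite kexpr_edge_sym (bad1 _ _ (has_label_vertices lu)) orbT.
Qed.

Lemma label_has_label e v x (i : 'I_k) : has_label e v x ->
  (kexpr_label e v == Some i) = (x == i).
Proof.
rewrite /has_label; case: kexpr_label => // l /eqP <-.
by apply/eqP/eqP => [[->]|/val_inj ->].
Qed.

Lemma existsb_or (A B : pred V) : [exists v, A v || B v] = [exists v, A v] || [exists v, B v].
Proof.
apply/existsP/orP => [[v /orP[] H]|[]/existsP[v H]]; last 2 first.
- by exists v; rewrite H.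
- by exists v; rewrite H orbT.
- by left; apply/existsP; exists v.
- by right; apply/existsP; exists v.
Qed.

Lemma existsb_and c (A : pred V) : [exists v, c && A v] = c && [exists v, A v].
Proof. by case: c => //=; apply/existsP => -[]. Qed.

(** Whether a vertex gains a neighbour with a given letter depends on its label
and on the letters present with the other label only. *)
Lemma facts_join (i j : 'I_k) e alpha :
  same_facts k (facts_of (Join i j e) alpha) (join_fact i j (facts_of e alpha)).
Proof.
have lab v a : has_label (Join i j e) v a = has_label e v a by [].
have labE v (l : 'I_k) : (kexpr_label e v == Some l) = has_label e v l by rewrite has_labelE.
move=> [|[|[|[|t]]]] x y z w // _ _ _ _ _; rewrite /join_fact [RHS]/=.
- apply/existsP/andP => [[v /andP[/andP[lv av] /forallP Hf]]|[/andP[/existsP[v /andP[/andP[lv av] /forallP Hf]] Hi] Hj]].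
    have Hx (l m : 'I_k) (c : nat) : (l = i /\ m = j) \/ (l = j /\ m = i) -> (c == z) || (c == w) ->
        ~~ ((x == l) && [exists v, has_label e v m && (alpha v == c)]).
      move=> lm czw; apply/negP => /andP[xl /existsP[u /andP[lu au]]].
      have := Hf u; rewrite /= !labE (eqP au) -!negb_or czw implybF !negb_or.
      case: lm lu xl => [[-> ->]|[-> ->]] lu xl; rewrite -!labE !(label_has_label _ lv) xl;
        by rewrite !labE lu /= ?andbF ?orbT.
    split; first (apply/andP; split).
    + apply/existsP; exists v; rewrite -lab lv av; apply/forallP => u.
      by have := Hf u; rewrite /=; case: (kexpr_edge e v u).
    + by rewrite andb_orr negb_or !Hx ?eqxx ?orbT //; left.
    + by rewrite andb_orr negb_or !Hx ?eqxx ?orbT //; right.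
  exists v; rewrite lab lv av; apply/forallP => u; apply/implyP => /=.
  rewrite !(label_has_label _ lv) !labE => /or3P[E|/andP[xi lu]|/andP[xj lu]].
  + by have := Hf u; rewrite E.
  + move: Hi; rewrite xi /= negb_or => /andP[/existsPn/(_ u) + /existsPn/(_ u)].
    by rewrite lu /= => -> ->.
  + move: Hj; rewrite xj /= negb_or => /andP[/existsPn/(_ u) + /existsPn/(_ u)].
    by rewrite lu /= => -> ->.
- rewrite [LHS]/=; apply/existsP/idP => [[v /existsP[u /and3P[]]]|].
    rewrite !labE => /or3P[E|/andP[lv lu]|/andP[lv lu]] av au.
    + by apply/orP; left; apply/orP; left; apply/existsP; exists v; apply/existsP; exists u; rewrite E av.
    + apply/orP; left; apply/orP; right; apply/andP; split; apply/existsP.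
        by exists v; rewrite lv.
      by exists u; rewrite lu.
    + apply/orP; right; apply/andP; split; apply/existsP.
        by exists v; rewrite lv.
      by exists u; rewrite lu.
  case/orP=> [/orP[/existsP[v /existsP[u /and3P[E av au]]]|]|].
  + by exists v; apply/existsP; exists u; rewrite E av.
  + case/andP=> /existsP[v /andP[lv av]] /existsP[u /andP[lu au]].
    by exists v; apply/existsP; exists u; rewrite !labE lv lu av au orbT.
  + case/andP=> /existsP[v /andP[lv av]] /existsP[u /andP[lu au]].
    by exists v; apply/existsP; exists u; rewrite !labE lv lu av au !orbT.
- apply/existsP/andP => [[v /existsP[u /and5P[lv av lu au]]]|[/andP[]/existsP[v /existsP[u /and5P[lv av lu au E]]] xi xj]].
    rewrite /= !(label_has_label _ lv) !(label_has_label _ lu) !negb_or => /and3P[E xi xj].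
    split=> //; apply/andP; split=> //; apply/existsP; exists v; apply/existsP; exists u.
    by rewrite -!lab lv av lu au E.
  exists v; apply/existsP; exists u.
  rewrite !lab lv av lu au /= !(label_has_label _ lv) !(label_has_label _ lu) !negb_or.
  by rewrite E xi xj.
Qed.

Lemma has_label_relabel (i j : 'I_k) e v a : has_label (Relabel i j e) v a =
  (a != i) && has_label e v a || (a == j) && has_label e v i.
Proof.
rewrite /has_label /=; case: (kexpr_label e v) => [l|] /=; last by rewrite !andbF.
rewrite (inj_eq (@Some_inj _)) -val_eqE /=; case: (eqVneq (l : nat) i) => [->|ne].
  by rewrite /= andbT (eq_sym (j : nat)) (eq_sym (i : nat)); case: (a == i).
by rewrite andbF orbF; case: (eqVneq (l : nat) a) => [<-|]; rewrite ?ne ?andbF.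
Qed.

Lemma facts_relabel (i j : 'I_k) e alpha :
  same_facts k (facts_of (Relabel i j e) alpha) (relabel_fact i j (facts_of e alpha)).
Proof.
have ex c d (A B : pred V) : c && [exists v, A v] || d && [exists v, B v] =
    [exists v, c && A v || d && B v].
  by rewrite existsb_or !existsb_and.
move=> [|[|[|[|t]]]] x y z w // _ _ _ _ _; rewrite /relabel_fact [RHS]/= [LHS]/=.
- rewrite ex; apply: eq_existsb => v; rewrite has_label_relabel.
  by case: (x != i); case: (x == j); case: (alpha v == y); rewrite /= ?andbT ?andbF ?orbF.
- rewrite ex; apply: eq_existsb => v; rewrite has_label_relabel.
  case: (x != i); case: (x == j); case: (alpha v == y); rewrite /= ?andbT ?andbF ?orbF //.
  by rewrite andb_orl.
- rewrite !ex; apply: eq_existsb => v; rewrite !ex; apply: eq_existsb => u.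
  rewrite !has_label_relabel; case: (alpha v == 6); case: (alpha u == 7); case: (kexpr_edge e v u);
    rewrite ?andbF ?andbT //=.
  by case: (x != i); case: (x == j); case: (y != i); case: (y == j);
    case: (has_label e v x); case: (has_label e v i); case: (has_label e u y);
    case: (has_label e u i).
Qed.

Lemma facts_ext e alpha beta : {in kexpr_vertices e, alpha =1 beta} ->
  same_facts k (facts_of e alpha) (facts_of e beta).
Proof.
move=> ab; have lab v a : has_label e v a -> alpha v = beta v.
  by move=> /has_label_vertices; apply: ab.
move=> [|[|[|[|t]]]] x y z w // _ _ _ _ _ /=.
- by apply: eq_existsb => v; case E: (has_label e v x) => //=; rewrite (lab _ _ E).
- apply: eq_existsb => v; case E: (has_label e v x) => //=; rewrite (lab _ _ E).
  congr (_ && _); apply: eq_forallb => u; case Eu: (kexpr_edge e v u) => //=.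
  by rewrite ab //; case/andP: (edge_vertices Eu).
- apply: eq_existsb => v; apply: eq_existsb => u; case Eu: (kexpr_edge e v u) => //=.
  by case/andP: (edge_vertices Eu) => v1 u1; rewrite !ab.
- apply: eq_existsb => v; apply: eq_existsb => u; case E: (has_label e v x) => //=.
  rewrite (lab _ _ E); case E': (has_label e u y); rewrite ?andbF //=.
  by rewrite (lab _ _ E').
Qed.

(** * Tables of an expression *)

(** Same format as the code of an expression, with a dummy label for the
union. *)
Fixpoint ops e : seq op :=
  match e with
  | Vertex i v => [:: (0, nat_of_ord i, nat_of_ord (enum_rank v))]
  | Union e1 e2 => ops e1 ++ ops e2 ++ [:: (1, 0, 0)]
  | Join i j e1 => ops e1 ++ [:: (2, nat_of_ord i, nat_of_ord j)]
  | Relabel i j e1 => ops e1 ++ [:: (3, nat_of_ord i, nat_of_ord j)]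
  end.

Fixpoint table e : nat -> nat :=
  match e with
  | Vertex i v => init k 0 i
  | Union e1 e2 => combine width trans k 1 0 0 (table e1) (table e2)
  | Join i j e1 => combine width trans k 2 i j (table e1) (init k 2 i)
  | Relabel i j e1 => combine width trans k 3 i j (table e1) (init k 3 i)
  end.

Lemma ops_code_ops e : ops_code (ops e) = kexpr_code e.
Proof.
rewrite /ops_code.
by elim: e => [i v|e1 IH1 e2 IH2|i j e IH|i j e IH] //=;
  rewrite !map_cat !flatten_cat ?IH ?IH1 ?IH2.
Qed.

Lemma size_ops e : size (ops e) = kexpr_size e.
Proof. by elim: e => //= *; rewrite !size_cat /=; lia. Qed.

Lemma run_ops_cat st cs1 cs2 : run_ops width init trans k st (cs1 ++ cs2) =
  obind (fun st' => run_ops width init trans k st' cs2) (run_ops width init trans k st cs1).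
Proof. by elim: cs1 st => //= c cs1 IH st; case: run_op. Qed.

Lemma run_ops_table e st : run_ops width init trans k st (ops e) = Some (table e :: st).
Proof.
have mk (i : 'I_k) : minn k i = i by apply/minn_idPr/ltnW.
elim: e st => [i v|e1 IH1 e2 IH2|i j e IH|i j e IH] st.
- by rewrite /= mk.
- by rewrite /ops -/ops !run_ops_cat IH1 [obind _ _]/= run_ops_cat IH2 /= !minn0.
- by rewrite /ops -/ops run_ops_cat IH /= !mk.
- by rewrite /ops -/ops run_ops_cat IH /= !mk.
Qed.

Lemma ops_le3 e : all (fun c : op => c.1.1 <= 3) (ops e).
Proof. by elim: e => //= [e1 IH1 e2 IH2|i j e IH|i j e IH]; rewrite !all_cat ?IH1 ?IH2 ?IH. Qed.

Definition state_of e alpha := encode k (facts_of e alpha).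
(** The vertices with letter 7 become singleton parts. *)
Definition weight e alpha := #|[set v in kexpr_vertices e | alpha v == 7]|.

Lemma lt_iteri_max n (g : nat -> nat) (P : pred nat) a0 w :
  (w < iteri n (fun i a => if P i then maxn a (g i) else a) a0) <->
  (w < a0 \/ exists i, [/\ i < n, P i & w < g i]).
Proof.
elim: n => [|n IH] /=; first by split=> [H|[//|[i []//]]]; left.
split=> [|[H|[i [lt Pi wi]]]].
- case: ifP => [Pn|_].
    rewrite leq_max => /orP[/IH[H|[i [lt Pi wi]]]|H]; [by left|right|right].
      by exists i; split=> //; rewrite ltnW.
    by exists n.
  by case/IH=> [H|[i [lt Pi wi]]]; [left|right; exists i; split=> //; rewrite ltnW].
- have {}H := IH.2 (or_introl H).
  by case: ifP => // _; rewrite leq_max H.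
- move: lt; rewrite ltnS leq_eqVlt => /orP[/eqP E|lt].
    by subst i; rewrite Pi leq_max wi orbT.
  have {}H : w < iteri n (fun i a => if P i then maxn a (g i) else a) a0.
    by apply/IH; right; exists i.
  by case: ifP => // _; rewrite leq_max H.
Qed.

Lemma lt_combine o i j X Y q w :
  w < combine width trans k o i j X Y q <->
  exists q1 q2, [/\ q1 < width k, q2 < width k, trans k o i j q1 q2 = q
    & [/\ 0 < X q1, 0 < Y q2 & w.+1 < X q1 + Y q2]].
Proof.
rewrite /combine; suff H n a0 : w < iteri n (fun q1 a =>
    iteri (width k) (fun q2 a => combine_step trans k o i j X Y q q1 q2 a) a) a0 <->
  w < a0 \/ exists q1 q2, [/\ q1 < n, q2 < width k, trans k o i j q1 q2 = q
     & [/\ 0 < X q1, 0 < Y q2 & w.+1 < X q1 + Y q2]].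
  by rewrite H; split=> [[//|]|]; [|right].
elim: n => [|n IH]; first by split=> [H|[//|[q1 [q2 []//]]]]; left.
rewrite iteriS /combine_step lt_iteri_max IH; split.
- case=> [[H|[q1 [q2 [lt1 lt2 E H]]]]|[q2 [lt /and3P[/eqP E X0 Y0] H]]].
  + by left.
  + by right; exists q1, q2; split=> //; apply: ltnW.
  + by right; exists n, q2; split=> //; split=> //; lia.
- case=> [H|[q1 [q2 [lt1 lt2 E [X0 Y0 H]]]]]; first by left; left.
  move: lt1; rewrite ltnS leq_eqVlt => /orP[/eqP e|lt1].
    subst q1; right; exists q2; split=> //; last by lia.
    by rewrite E eqxx X0 Y0.
  by left; right; exists q1, q2.
Qed.

(** For a union, annotations of the two components are glued along the disjoint
sets of vertices; the weight is additive and the state is determined by those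
of the components. *)
Lemma tableP e q w : kexpr_wf e ->
  w < table e q <->
  exists alpha, [/\ forall v, alpha v < 9, state_of e alpha = q & w <= weight e alpha].
Proof.
have ltR (i : 'I_k) : i < radix k by rewrite /radix; have := ltn_ord i; lia.
have R0 : 0 < radix k by have := radix_gt k; lia.
have unary o (i j : 'I_k) e0 e' : o != 0 ->
    (forall alpha, same_facts k (facts_of e' alpha) (step_fact o i j (facts_of e0 alpha) (fun _ _ _ _ _ => false))) ->
    kexpr_vertices e' = kexpr_vertices e0 ->
    (forall q w, w < table e0 q <->
      exists alpha, [/\ forall v, alpha v < 9, state_of e0 alpha = q & w <= weight e0 alpha]) ->
    forall q w, w < combine width trans k o i j (table e0) (init k o i) q <->
      exists alpha, [/\ forall v, alpha v < 9, state_of e' alpha = q & w <= weight e' alpha].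
  move=> o0 Hstep Hv IH q' w'.
  have init0 q2 : init k o i q2 = (q2 == 0) by rewrite /init (negPf o0).
  have enc0 : encode k (fun _ _ _ _ _ => false) = 0.
    by rewrite /encode big1.
  have stE alpha : state_of e' alpha = trans k o i j (state_of e0 alpha) 0.
    by rewrite /state_of -enc0 trans_encode //; apply: encode_ext.
  have wE alpha : weight e' alpha = weight e0 alpha by rewrite /weight Hv.
  rewrite lt_combine; split.
    case=> q1 [q2 [lt1 lt2 E [X0 Y0 H]]]; move: Y0 H; rewrite init0 lt0b => /eqP q20.
    rewrite q20 in E *; rewrite eqxx addn1 ltnS => /IH[alpha [al9 sta walpha]].
    by exists alpha; rewrite stE wE sta.
  case=> alpha [al9 sta walpha].
  have H : w' < table e0 (state_of e0 alpha) by apply/IH; exists alpha; rewrite -wE.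
  exists (state_of e0 alpha), 0; rewrite init0 eqxx -stE addn1 ltnS; split=> //; try exact: encode_lt.
  - by rewrite /width expn_gt0.
  - by split=> //; apply: leq_ltn_trans H.
elim: e q w => [i v|e1 IH1 e2 IH2|i j e IH|i j e IH] q w /=.
- move=> _; have stv alpha : state_of (Vertex i v) alpha = encode k (leaf_fact i (alpha v)).
    by apply: encode_ext; apply: facts_vertex.
  have wv alpha : weight (Vertex i v) alpha = (alpha v == 7).
    rewrite /weight /=; case: eqP => av.
      by rewrite (_ : [set _ in _ | _] = [set v]) ?cards1 //; apply/setP => u; rewrite !inE;
        case: eqP => // ->; rewrite av.
    by apply/eqP; rewrite cards_eq0; apply/eqP/setP => u; rewrite !inE;
      case: eqP => // ->; apply/eqP.
  have -> : w < init k 0 i q <-> exists2 p, p < 9 & encode k (leaf_fact i p) = q /\ w <= (p == 7).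
    rewrite /init eqxx; case: eqP => [E|ne].
      split=> [w2|[p p9 [_ wp]]]; first by exists 7.
      by case: (p == 7) wp => /=; lia.
    case: ifP => [/allP H|/negbT/allPn[p]].
      by split=> // -[p p9 [E _]]; have := H p; rewrite mem_iota E eqxx => /(_ p9).
    rewrite mem_iota negbK => p9 /eqP E; split=> [w1|[p' p9' [E' wp]]].
      by exists p => //; split=> //; lia.
    by move: wp; case: eqP => [e7|_]; [case: ne; rewrite -E' e7|lia].
  split=> [[p p9 [E wp]]|[alpha [al9 E wal]]].
    by exists (fun=> p); rewrite stv wv.
  by exists (alpha v) => //; rewrite -stv -wv.
- case/and3P=> wf1 wf2 dis.
  have stU alpha : state_of (Union e1 e2) alpha = trans k 1 0 0 (state_of e1 alpha) (state_of e2 alpha).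
    by rewrite /state_of trans_encode //; apply: encode_ext; apply: facts_union.
  have wU alpha : weight (Union e1 e2) alpha = weight e1 alpha + weight e2 alpha.
    rewrite /weight /= (_ : [set v in _ | _] = [set v in kexpr_vertices e1 | alpha v == 7]
      :|: [set v in kexpr_vertices e2 | alpha v == 7]); last first.
      by apply/setP => v; rewrite !inE andb_orl.
    rewrite cardsU (_ : _ :&: _ = set0) ?cards0 ?subn0 //.
    apply/setP => v; rewrite !inE; case v1: (v \in kexpr_vertices e1); rewrite ?andbF //=.
    by rewrite (disjointFr dis v1) andbF.
  rewrite lt_combine; split.
    case=> q1 [q2 [lt1 lt2 E [X0 Y0 H]]].
    have wit e0 p : (forall q w, w < table e0 q <->
        exists alpha, [/\ forall v, alpha v < 9, state_of e0 alpha = q & w <= weight e0 alpha]) ->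
        0 < table e0 p -> exists alpha, [/\ forall v, alpha v < 9, state_of e0 alpha = p &
          table e0 p <= (weight e0 alpha).+1].
      move=> IH T0; have [|al [al9 sta wal]] := (IH p (table e0 p).-1).1; first by rewrite prednK.
      by exists al; split=> //; rewrite -(prednK T0).
    have [al1 [al19 st1 w1]] := wit e1 q1 (fun q w => IH1 q w wf1) X0.
    have [al2 [al29 st2 w2]] := wit e2 q2 (fun q w => IH2 q w wf2) Y0.
    (* The annotations of the two components, glued. *)
    pose al v := if v \in kexpr_vertices e1 then al1 v else al2 v.
    have e1al : {in kexpr_vertices e1, al =1 al1} by move=> v v1; rewrite /al v1.
    have e2al : {in kexpr_vertices e2, al =1 al2} by move=> v v2; rewrite /al (disjointFl dis v2).
    have wext e0 a b : {in kexpr_vertices e0, a =1 b} -> weight e0 a = weight e0 b.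
      move=> ab; rewrite /weight; congr #|pred_of_set _|; apply/setP => v; rewrite !inE.
      by case v1: (v \in _) => //=; rewrite ab.
    exists al; split.
    + by move=> v; rewrite /al; case: ifP.
    + rewrite stU -E -st1 -st2; congr trans; apply: encode_ext; exact: facts_ext.
    + by rewrite wU (wext _ _ _ e1al) (wext _ _ _ e2al); lia.
  case=> al [al9 sta wal].
  have H1 : weight e1 al < table e1 (state_of e1 al) by apply/(IH1 _ _ wf1); exists al.
  have H2 : weight e2 al < table e2 (state_of e2 al) by apply/(IH2 _ _ wf2); exists al.
  exists (state_of e1 al), (state_of e2 al); rewrite -stU; split=> //; try exact: encode_lt.
  by rewrite wU in wal; split; lia.
- case/andP=> _ wf; apply: unary => //.
    by move=> alpha t x y z u *; rewrite facts_join.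
  by move=> q' w'; apply: IH.
- case/andP=> _ wf; apply: unary => //.
    by move=> alpha t x y z u *; rewrite facts_relabel.
  by move=> q' w'; apply: IH.
Qed.

Lemma le_best (T : nat -> nat) r : 0 < r ->
  r <= best width final k T <->
  exists q, [/\ q < width k, 0 < T q, 0 < final k q & r + 2 <= T q + final k q].
Proof.
case: r => // r _; rewrite /best lt_iteri_max; split.
- by case=> [//|[q [qw /andP[T0 f0] H]]]; exists q; split=> //; lia.
- by case=> q [qw T0 f0 H]; right; exists q; split=> //; [rewrite T0 f0|lia].
Qed.

(** The entries of a table and the bonus both are one too large, whence the
strict inequality. *)
Lemma best_table e r : kexpr_wf e -> 0 < r ->
  r <= best width final k (table e) <->
  exists alpha, [/\ forall v, alpha v < 9, 0 < bonus k (facts_of e alpha)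
    & r < weight e alpha + bonus k (facts_of e alpha)].
Proof.
move=> wf r0; rewrite le_best //; split.
- case=> q [qw T0 f0 H].
  have [|al [al9 sta wal]] := (tableP q (table e q).-1 wf).1; first by rewrite prednK.
  have fE : final k q = bonus k (facts_of e al) by rewrite -sta final_encode.
  by exists al; rewrite -fE; split=> //; lia.
- case=> al [al9 b0 H].
  have wT : weight e al < table e (state_of e al) by apply/(tableP _ _ wf); exists al.
  by exists (state_of e al); rewrite final_encode; split=> //; [apply: encode_lt|lia|lia].
Qed.

End Semantics.

(** * Coalition partitions *)

Section Graph.
Variable G : sgraph.
Implicit Types (X Y D : {set G}) (Psi : {set {set G}}).

Lemma toidsP D : reflect
  ((forall v, exists2 u, u \in D & edge v u) /\ (forall u v, edge u v -> (u \in D) || (v \in D)))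
  (toids D).
Proof.
apply: (iffP andP) => -[H1 H2]; split.
- by move=> v; have /forallP/(_ v)/existsP[u /andP[uD vu]] := H1; exists u.
- move=> u v uv; have [//|uD] := boolP (u \in D).
  have /forallP/(_ u) := H2; rewrite inE uD => /forallP/(_ v); rewrite inE uv implybF negbK.
  by rewrite orFb.
- by apply/forallP => v; have [u uD vu] := H1 v; apply/existsP; exists u; rewrite uD.
- apply/forallP => u; apply/implyP; rewrite inE => uD; apply/forallP => v; apply/implyP.
  by rewrite inE => vD; apply/negP => /H2; rewrite (negPf uD) (negPf vD).
Qed.

Lemma toi_coalitionC X Y : toi_coalition X Y = toi_coalition Y X.
Proof.
rewrite /toi_coalition setUC disjoint_sym; case: (X != set0); case: (Y != set0) => //=.
by case: (toids X); case: (toids Y); rewrite ?andbF.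
Qed.

Lemma coloring_toic (T : finType) (beta : G -> T) :
  (forall v, exists2 w, beta w != beta v &
     toi_coalition [set x | beta x == beta v] [set x | beta x == beta w]) ->
  #|[set beta v | v : G]| <= toi_coalition_number G.
Proof.
move=> H; pose cls c := [set x | beta x == c].
pose Psi := [set cls (beta v) | v : G].
have clsI v w : w \in cls (beta v) -> cls (beta w) = cls (beta v).
  by rewrite inE => /eqP E; rewrite /cls E.
have cardPsi : #|Psi| = #|[set beta v | v : G]|.
  rewrite /Psi (_ : imset _ _ = cls @: [set beta v | v : G]); last exact: imset_comp.
  apply: card_in_imset => c d /imsetP[v _ ->] /imsetP[w _ ->] E.
  have : v \in cls (beta w) by rewrite -E inE.
  by rewrite inE => /eqP.
suff HPsi : toic_partition Psi.
  by rewrite -cardPsi; apply: (leq_bigmax_cond (F := fun Psi : {set {set G}} => #|Psi|)).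
apply/andP; split.
- apply/and3P; split.
  + apply/eqP/setP => v; rewrite inE; apply/bigcupP; exists (cls (beta v)); last by rewrite inE.
    exact: imset_f.
  + apply/trivIsetP => _ _ /imsetP[v _ ->] /imsetP[w _ ->]; apply: contraR.
    case/pred0Pn=> x /andP[/clsI <- /clsI <-]; exact: eqxx.
  + by apply/imsetP => -[v _ /setP/(_ v)]; rewrite !inE eqxx.
- apply/forallP => X; apply/implyP => /imsetP[v _ ->].
  have [w wv Hw] := H v; apply/existsP; exists (cls (beta w)).
  have -> : cls (beta w) \in Psi by exact: imset_f.
  rewrite Hw andbT; apply: contra wv => /eqP E.
  by have : w \in cls (beta v) by [rewrite -E inE]; rewrite inE.
Qed.

Definition nbhd (v : G) : {set G} := [set w | edge v w].

Section Partition.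
Variable Psi : {set {set G}}.
Hypothesis toicPsi : toic_partition Psi.

Lemma partPsi : partition Psi [set: G]. Proof. by case/andP: toicPsi. Qed.

Lemma partner X : X \in Psi -> exists2 Y, Y \in Psi & (Y != X) && toi_coalition X Y.
Proof.
case/andP: toicPsi => _ /forallP/(_ X)/implyP H /H/existsP[Y /andP[YP HY]]; by exists Y.
Qed.

Lemma block_in v : pblock Psi v \in Psi.
Proof. by apply: pblock_mem; case/and3P: partPsi => /eqP ->; rewrite inE. Qed.

Lemma mem_block v : v \in pblock Psi v.
Proof. by rewrite mem_pblock; case/and3P: partPsi => /eqP ->; rewrite inE. Qed.

Lemma block_eq X v : X \in Psi -> v \in X -> pblock Psi v = X.
Proof. by case/and3P: partPsi => _ tI _; apply: def_pblock. Qed.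

Lemma block_inhab X : X \in Psi -> exists v, v \in X.
Proof.
case/and3P: partPsi => _ _ n0 XP; apply/set0Pn; apply: contraNneq n0 => E.
by rewrite -E.
Qed.

Lemma coalition_toids X Y : toi_coalition X Y -> toids (X :|: Y).
Proof. by case/and5P => _ _ _ _ /andP[]. Qed.

(** The ends of one edge lie in parts [A] and [B] that meet all coalitions, so
that [A] or [B] has three partners.  If three coalitions share exactly the part
[Z], the two ends of an edge cannot meet all of them without meeting [Z].  Then
the union of the other parts is independent, so that no two of them can form a
coalition. *)
Lemma star_of_large : 6 < #|Psi| ->
  exists2 A, A \in Psi & (forall X, X \in Psi -> X != A -> toi_coalition A X) /\
    (forall u v, edge u v -> (u \in A) || (v \in A)).
Proof.
move=> big.
have /card_gt0P[X0 X0P] : 0 < #|Psi| by lia.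
have [Y0 Y0P /andP[_ XY0]] := partner X0P.
have [v0 _] := block_inhab X0P.
have [u0 _ v0u0] := (toidsP _ (coalition_toids XY0)).1 v0.
pose A := pblock Psi v0; pose B := pblock Psi u0.
pose N Z := [set X in Psi | toi_coalition Z X].
have others X : X \in Psi -> X != A -> X != B -> (X \in N A) || (X \in N B).
  move=> XP XA XB; have [Y YP /andP[_ XY]] := partner XP.
  have := (toidsP _ (coalition_toids XY)).2 _ _ v0u0; rewrite !inE XP /=.
  case/orP=> /orP[] H.
  - by rewrite -(block_eq XP H) eqxx in XA.
  - by rewrite /A (block_eq YP H) toi_coalitionC XY.
  - by rewrite -(block_eq XP H) eqxx in XB.
  - by rewrite /B (block_eq YP H) (toi_coalitionC Y) XY orbT.
have sub : Psi \subset [set A; B] :|: (N A :|: N B).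
  apply/subsetP => X XP; rewrite !inE.
  have [//|XA] := eqVneq X A; have [//|XB] := eqVneq X B.
  by have := others X XP XA XB; rewrite !inE XP.
have [Z ZP ZN] : exists2 Z, Z \in Psi & 2 < #|N Z|.
  have H : #|Psi| <= #|[set A; B]| + #|N A :|: N B|.
    by apply: leq_trans (subset_leq_card sub) _; exact: leq_card_setU.
  have H2 : #|N A :|: N B| <= #|N A| + #|N B| by exact: leq_card_setU.
  have H3 : #|[set A; B]| <= 2 by rewrite cards2; case: (_ != _).
  have [|H4] := leqP 3 #|N A|; first by exists A => //; apply: block_in.
  by exists B; [apply: block_in|lia].
have Zcov u v : edge u v -> (u \in Z) || (v \in Z).
  move=> uv; apply/negPn/negP; rewrite negb_or => /andP[uZ vZ].
  have /subsetPn[C] : ~~ (N Z \subset [set pblock Psi u; pblock Psi v]).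
    apply/negP => /subset_leq_card H; have : #|N Z| <= 2; last by lia.
    by apply: leq_trans H _; rewrite cards2; case: (_ != _).
  rewrite !inE => /andP[CP ZC] /norP[Cu Cv].
  have := (toidsP _ (coalition_toids ZC)).2 _ _ uv; rewrite !inE (negPf uZ) (negPf vZ) /=.
  by case/orP=> H; [rewrite (block_eq CP H) eqxx in Cu|rewrite (block_eq CP H) eqxx in Cv].
exists Z => //; split=> // X XP XZ; have [Y YP /andP[YX XY]] := partner XP.
have [YZ|YZ] := eqVneq Y Z; first by rewrite -YZ toi_coalitionC.
have disj W w : W \in Psi -> W != Z -> w \in W -> w \notin Z.
  by move=> WP WZ wW; apply: contra WZ => wZ; rewrite -(block_eq WP wW) (block_eq ZP wZ).
have [x xX] := block_inhab XP.
have [u uXY xu] := (toidsP _ (coalition_toids XY)).1 x.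
have := Zcov _ _ xu; rewrite (negPf (disj _ _ XP XZ xX)) /=.
by move: uXY; rewrite inE => /orP[] H; rewrite (negPf (disj _ _ _ _ H)).
Qed.

(** Let [A] be the part given by [star_of_large].  Its vertices without a
neighbour in [A] are what keeps it from being a TOIDS, and every other part
must contain a neighbour of each of them.  A vertex with a neighbourhood inside
that of [u0] is again of this kind, whence equality by the choice of [u0] with
the smallest neighbourhood. *)
Lemma min_neighbourhood : 6 < #|Psi| -> exists u0 : G,
  [/\ #|Psi| <= #|nbhd u0|.+1, nbhd u0 != set0,
      {in nbhd u0 &, forall v w, ~~ edge v w},
      (forall v : G, exists w, edge v w) &
      forall v, nbhd v \subset nbhd u0 -> (v \notin nbhd u0) /\ nbhd v = nbhd u0].
Proof.
move=> big; have [A AP [star cov]] := star_of_large big.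
have [X0 X0P X0A] : exists2 X, X \in Psi & X != A.
  have /subsetPn[X XP] : ~~ (Psi \subset [set A]).
    by apply/negP => /subset_leq_card; rewrite cards1; lia.
  by rewrite inE; exists X.
have nbr (v : G) : exists w, edge v w.
  by have [w _ vw] := (toidsP _ (coalition_toids (star _ X0P X0A))).1 v; exists w.
pose U := [set u | [disjoint nbhd u & A]].
have UA u : u \in U -> u \in A.
  rewrite inE => /pred0P dis; have [w uw] := nbr u.
  by have := cov _ _ uw; have := dis w; rewrite !inE uw /= => ->; rewrite orbF.
have /set0Pn[u1 u1U] : U != set0.
  apply/negP => /eqP U0; have /and5P[_ _ _ /negP nA _] := star _ X0P X0A; case: nA.
  apply/toidsP; split=> // v; have := in_set0 v; rewrite -U0 inE => /negbT/pred0Pn[w].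
  by rewrite !inE => /andP[vw wA]; exists w.
pose u0 := [arg min_(u < u1 in U) #|nbhd u|].
have [u0U u0min] : u0 \in U /\ forall u, u \in U -> #|nbhd u0| <= #|nbhd u|.
  by rewrite /u0; case: arg_minnP.
have N0A w : w \in nbhd u0 -> w \notin A.
  by move=> wN; move: u0U; rewrite inE => /pred0P/(_ w); rewrite /= wN /= => ->.
exists u0; split=> //.
- have sub : Psi :\ A \subset [set pblock Psi w | w in nbhd u0].
    apply/subsetP => X; rewrite !inE => /andP[XA XP].
    have [w wAX u0w] := (toidsP _ (coalition_toids (star _ XP XA))).1 u0.
    have wX : w \in X.
      by move: wAX; rewrite inE => /orP[wA|//]; move: (N0A w); rewrite inE u0w wA => /(_ isT).
    by apply/imsetP; exists w; rewrite ?inE // (block_eq XP wX).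
  rewrite (cardsD1 A) AP add1n ltnS.
  exact: leq_trans (subset_leq_card sub) (leq_imset_card _ _).
- by have [w u0w] := nbr u0; apply/set0Pn; exists w; rewrite inE.
- by move=> v w /N0A vA /N0A wA; apply/negP => /cov; rewrite (negPf vA) (negPf wA).
- move=> v sub; have [w vw] := nbr v.
  have vU : v \in U.
    by rewrite inE; apply/pred0P => x /=; apply/negP => /andP[/(subsetP sub)/N0A/negPf->].
  split; first by apply/negP => /N0A; rewrite UA.
  by apply/eqP; rewrite eqEcard sub u0min.
Qed.

End Partition.

(** * Annotations and coalition partitions *)

Section Annotation.
Variables (k : nat) (e : kexpr G k).
Hypothesis eG : kexpr_of e.
Variable alpha : G -> nat.
Hypothesis alpha9 : forall v, alpha v < 9.

Let P := facts_of e alpha.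

Lemma edgeE u v : kexpr_edge e u v = edge u v.
Proof. by case: eG. Qed.

Lemma labelled v : exists2 a, a < k & has_label e v a.
Proof.
have [_ Vs _] := eG; have : v \in kexpr_vertices e by rewrite Vs inE.
rewrite -label_vertices /has_label; case: kexpr_label => // i _.
by exists i; rewrite ?eqxx // ltn_ord.
Qed.

Lemma presentP p : reflect (exists v, alpha v = p) (present k P p).
Proof.
apply: (iffP allPn) => [[a _]|[v av]].
  by rewrite negbK => /existsP[v /andP[_ /eqP <-]]; exists v.
have [a ak va] := labelled v; exists a; first by rewrite mem_iota.
by rewrite negbK; apply/existsP; exists v; rewrite va av /=.
Qed.

Lemma seesP x p q : reflect (forall v, alpha v = x -> exists2 u, edge v u & (alpha u == p) || (alpha u == q))
  (all (fun a => ~~ P 1 a x p q) (iota 0 k)).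
Proof.
apply: (iffP allP) => [H v avx|H a].
  have [a ak va] := labelled v.
  have := H a; rewrite mem_iota ak => /(_ isT)/existsPn/(_ v).
  rewrite va avx eqxx => /forallPn[u]; rewrite edgeE negb_imply negb_and !negbK => /andP[vu au].
  by exists u.
move=> _; apply/existsPn => v; apply/negP => /andP[/andP[_ /eqP avx] /forallP Hf].
have [u vu au] := H v avx; have := Hf u; rewrite edgeE vu /=.
by case/orP: au => ->; rewrite ?andbF.
Qed.

Lemma edgeP x y : reflect (exists u v, [/\ edge u v, alpha u = x & alpha v = y]) (P 2 x y 0 0).
Proof.
apply: (iffP existsP) => [[u /existsP[v /and3P[]]]|[u [v [uv au av]]]].
  by rewrite edgeE => uv /eqP au /eqP av; exists u, v.
by exists u; apply/existsP; exists v; rewrite edgeE uv au av !eqxx.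
Qed.

Lemma all_iotaP n (Q : pred nat) : reflect (forall i, i < n -> Q i) (all Q (iota 0 n)).
Proof.
by apply: (iffP allP) => H i; have := H i; rewrite mem_iota.
Qed.

Definition letters p q := [set v | alpha v == p] :|: [set v | alpha v == q].

Lemma toids_factE p q : p < 9 -> q < 9 -> toids_fact k P p q = toids (letters p q).
Proof.
move=> p9 q9; apply/andP/toidsP => -[H1 H2]; split.
- move=> v; move/all_iotaP: H1 => H1.
  have dom : all (fun x => all (fun a => ~~ P 1 a x p q) (iota 0 k)) (iota 0 9).
    by apply/all_iotaP => x x9; apply/all_iotaP => a ak; have /all_iotaP := H1 a ak; apply.
  have /all_iotaP/(_ _ (alpha9 v))/seesP/(_ v erefl)[u vu au] := dom.
  by exists u; rewrite ?inE.
- move=> u v uv; have /all_iotaP/(_ _ (alpha9 u))/all_iotaP/(_ _ (alpha9 v)) := H2.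
  rewrite !inE; have -> : P 2 (alpha u) (alpha v) 0 0 by apply/edgeP; exists u, v.
  by rewrite orbA.
- apply/all_iotaP => a ak; apply/all_iotaP => x x9.
  have /all_iotaP : all (fun a => ~~ P 1 a x p q) (iota 0 k); last exact.
  by apply/seesP => v _; have [u] := H1 v; rewrite !inE => au vu; exists u.
- apply/all_iotaP => x x9; apply/all_iotaP => y y9.
  case E: (P 2 x y 0 0) => //=; have /edgeP[u [v [uv <- <-]]] := E.
  by have := H2 u v uv; rewrite !inE -!orbA.
Qed.

Lemma letters_same p : letters p p = [set v | alpha v == p].
Proof. exact: setUid. Qed.

Lemma coloring_okP : coloring_ok k P <->
  (forall v, alpha v < 6) /\
  forall v, exists2 w, alpha w != alpha v &
    toi_coalition [set x | alpha x == alpha v] [set x | alpha x == alpha w].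
Proof.
split.
- case/andP=> /all_iotaP H6 /all_iotaP Hp.
  have a6 v : alpha v < 6.
    by have := H6 _ (alpha9 v); have -> : present k P (alpha v) by apply/presentP; exists v.
  split=> // v; have := Hp _ (a6 v).
  have -> : present k P (alpha v) by apply/presentP; exists v.
  case/allPn=> q; rewrite mem_iota negbK => /= q6 /andP[/andP[qv /presentP[w aw]] /andP[/andP[gp gq] gpq]].
  subst q; exists w => //; rewrite /toi_coalition.
  rewrite !toids_factE // !letters_same in gp gq gpq.
  rewrite gp gq gpq !andbT; apply/and3P; split.
  + by apply/set0Pn; exists v; rewrite inE.
  + by apply/set0Pn; exists w; rewrite inE.
  + apply/pred0P => x /=; rewrite !inE; case: eqP => // ->.
    by rewrite eq_sym (negPf qv).
- case=> a6 H; apply/andP; split.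
    by apply/all_iotaP => p p9; case: presentP => //= -[v <-].
  apply/all_iotaP => p p6; case: presentP => // -[v <-] {p p6}; apply/orP; right.
  have [w wv /and5P[_ _ _ gv /andP[gw gvw]]] := H v.
  apply/allPn; exists (alpha w); first by rewrite mem_iota /= a6.
  have -> : present k P (alpha w) by apply/presentP; exists w.
  by rewrite negbK wv !toids_factE // !letters_same gv gw.
Qed.

Lemma star_okP : star_ok k P <->
  [/\ forall v, 6 <= alpha v, exists u, alpha u = 6, exists s, alpha s = 7 &
   [/\ forall u v, edge u v -> alpha u = 6 -> alpha v = 7,
       forall u v, edge u v -> alpha u = 7 -> alpha v != 7,
       forall v, alpha v = 8 -> exists2 u, edge v u & alpha u = 8 &
       forall u s, alpha u = 6 -> alpha s = 7 -> edge u s]].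
Proof.
have no p q : ~~ P 2 p q 0 0 <-> (forall u v, edge u v -> alpha u = p -> alpha v != q).
  split=> [H u v uv au|H].
    by apply: contra H => /eqP av; apply/edgeP; exists u, v.
  by apply/negP => /edgeP[u [v [uv au /eqP av]]]; have := H u v uv au; rewrite av.
have pend : all (fun a => all (fun b => ~~ P 3 a b 0 0) (iota 0 k)) (iota 0 k) <->
    (forall u s, alpha u = 6 -> alpha s = 7 -> edge u s).
  split=> [/all_iotaP H u s au sa|H].
    have [a ak ua] := labelled u; have [b bk sb] := labelled s.
    have /all_iotaP/(_ _ bk)/existsPn/(_ u)/existsPn/(_ s) := H _ ak.
    by rewrite ua au sb sa !eqxx edgeE /= negbK.
  apply/all_iotaP => a ak; apply/all_iotaP => b bk; apply/existsPn => u; apply/existsPn => s.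
  apply/negP => /and5P[_ /eqP au _ /eqP sa]; rewrite edgeE H //.
have le8 v : 6 <= alpha v -> [|| alpha v == 6, alpha v == 7 | alpha v == 8].
  by have := alpha9 v; lia.
split.
- case/andP=> /all_iotaP H6 /andP[/andP[/andP[/andP[/presentP[u0 u06] /presentP[s0 s07]]]]].
  case/andP=> /andP[/no H66 /no H68] /no H77 /seesP H88 /pend Hp.
  have a6 v : 6 <= alpha v.
    by have := H6 _ (alpha9 v); have -> : present k P (alpha v) by apply/presentP; exists v.
  split=> //; [by exists u0|by exists s0|split=> //].
  + move=> u v uv au; have := le8 _ (a6 v).
    by rewrite (negPf (H66 _ _ uv au)) (negPf (H68 _ _ uv au)) orbF => /eqP.
  + by move=> v /H88[u vu]; rewrite orbb => /eqP; exists u.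
- case=> a6 [u0 u06] [s0 s07] [H67 H77 H88 Hp].
  apply/andP; split; first by apply/all_iotaP => p p9; case: presentP => //= -[v <-].
  apply/andP; split; last exact/pend.
  apply/andP; split; last by apply/seesP => v /H88[u vu au]; exists u; rewrite // au.
  apply/andP; split; first by apply/andP; split; apply/presentP; [exists u0|exists s0].
  by apply/andP; split; [apply/andP; split|]; apply/no => u v uv au; rewrite ?(H67 _ _ uv au) //; apply: H77 uv au.
Qed.

Lemma weightE : weight e alpha = #|[set v | alpha v == 7]|.
Proof.
have [_ Vs _] := eG; rewrite /weight Vs; congr #|pred_of_set _|.
by apply/setP => v; rewrite !inE.
Qed.

(** In the case of a star, the vertices without letter 7 are the centre: those
with letter 6 keep it from being a TOIDS, and each vertex with letter 7 is
adjacent to all of them. *)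
Lemma annotation_le : 0 < bonus k P ->
  weight e alpha + bonus k P <= (toi_coalition_number G).+1.
Proof.
rewrite /bonus; case E: (coloring_ok k P).
  have [a6 H] := (coloring_okP).1 E => _.
  have -> : weight e alpha = 0.
    rewrite weightE; apply/eqP; rewrite cards_eq0; apply/eqP/setP => v; rewrite !inE.
    by rewrite ltn_eqF // (leq_trans (a6 v)).
  pose beta v : 'I_6 := Ordinal (a6 v).
  have -> : \sum_(0 <= p < 6) present k P p = #|[set beta v | v : G]|.
    rewrite big_mkord -sum1_card [RHS]big_mkcond; apply: eq_bigr => p _.
    case: presentP => [[v av]|no].
      by rewrite (_ : p = beta v) ?imset_f //; apply: val_inj.
    by case: ifP => // /imsetP[v _ pv]; case: no; exists v; rewrite pv.
  by rewrite add0n addn1 ltnS; apply: coloring_toic => v; have [w wv Hw] := H v; exists w.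
case S: (star_ok k P) => // _; rewrite addn2 !ltnS.
have [a6 [u0 u06] [s0 s07] [H67 H77 H88 Hp]] := (star_okP).1 S.
pose S7 := [set v | alpha v == 7].
pose beta v := if alpha v == 7 then v else u0.
have -> : (weight e alpha).+1 = #|[set beta v | v : G]|.
  rewrite (_ : [set beta v | v : G] = u0 |: S7); first by rewrite cardsU1 inE u06 weightE.
  apply/esym/setP => v; rewrite !inE; apply/orP/imsetP.
  - by case=> [/eqP ->|av]; [exists u0|exists v] => //; rewrite /beta ?u06 ?av.
  - by case=> w _ ->; rewrite /beta; case: ifP => [->|_]; [right|left].
have cover s : alpha s = 7 -> toi_coalition [set x | beta x == u0] [set x | beta x == s].
  move=> s7; have su : s != u0 by apply/eqP => E'; rewrite E' u06 in s7.
  have inA x : (x \in [set x | beta x == u0]) = (alpha x != 7).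
    rewrite inE /beta; case: (eqVneq (alpha x) 7) => [x7|_]; last by rewrite eqxx.
    by apply/eqP => E'; rewrite E' u06 in x7.
  have inS x : (x \in [set x | beta x == s]) = (x == s).
    rewrite inE /beta; case: (eqVneq (alpha x) 7) => // x7; rewrite eq_sym (negPf su).
    by apply/esym/eqP => E'; rewrite E' s7 in x7.
  rewrite /toi_coalition; apply/and5P; split; last (apply/andP; split).
  - by apply/set0Pn; exists u0; rewrite inA u06.
  - by apply/set0Pn; exists s; rewrite inS.
  - by apply/pred0P => x /=; rewrite inA inS; case: (eqVneq x s) => [->|_]; rewrite ?andbF // s7.
  - apply/negP => /toidsP[/(_ u0)[w]]; rewrite inA => w7 u0w _.
    by rewrite (H67 _ _ u0w u06) in w7.
  - by apply/negP => /toidsP[/(_ s)[w]]; rewrite inS => /eqP ->; rewrite edge_irrefl.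
  - apply/toidsP; split.
      move=> v; have /or3P[/eqP a|/eqP a|/eqP a] : [|| alpha v == 6, alpha v == 7 | alpha v == 8].
      + by have := alpha9 v; have := a6 v; lia.
      + by exists s; [rewrite in_setU inS eqxx orbT|apply: Hp].
      + by exists u0; [rewrite in_setU inA u06|rewrite edge_sym; apply: Hp].
      + by have [u vu u8] := H88 v a; exists u; rewrite // in_setU inA u8.
    move=> u v uv; rewrite !in_setU !inA !inS.
    by case: eqP => //= u7; rewrite (H77 _ _ uv u7) orbT.
apply: coloring_toic => v; have [v7|v7] := eqVneq (alpha v) 7.
- exists u0; rewrite /beta v7 u06 /=; first by apply/eqP => E'; rewrite -E' u06 in v7.
  by rewrite toi_coalitionC; apply: cover.
- exists s0; rewrite /beta (negPf v7) s07 /=; last exact: cover.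
  by apply/eqP => E'; rewrite E' u06 in s07.
Qed.

End Annotation.

(** A partition into at most six parts is a colouring; for a larger one the
neighbourhood of [min_neighbourhood] yields an annotation of at least the same
value, which may describe another partition. *)
Lemma annotation_exists (k : nat) (e : kexpr G k) r : kexpr_of e -> 0 < r ->
  r <= toi_coalition_number G ->
  exists alpha, [/\ forall v, alpha v < 9, 0 < bonus k (facts_of e alpha)
    & r < weight e alpha + bonus k (facts_of e alpha)].
Proof.
move=> eG r0 rC.
have [Psi toicPsi rPsi] : exists2 Psi : {set {set G}}, toic_partition Psi & r <= #|Psi|.
  apply/exists_inP; apply: contraTT rC; rewrite negb_exists_in => /forall_inP H.
  rewrite -ltnNge; apply: (@leq_ltn_trans r.-1); last by lia.
  by apply/bigmax_leqP => Psi /H; lia.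
have [small|big] := leqP #|Psi| 6.
  (* The letter of a vertex is the number of its part. *)
  pose alpha v := index (pblock Psi v) (enum Psi).
  have inPsi v : pblock Psi v \in enum Psi by rewrite mem_enum block_in.
  have aP v : alpha v < #|Psi| by rewrite cardE index_mem.
  have a9 v : alpha v < 9 by have := aP v; lia.
  have cls v : [set x | alpha x == alpha v] = pblock Psi v.
    apply/setP => x; rewrite inE; apply/eqP/idP => [E|xv].
      have := mem_block toicPsi x; rewrite -(nth_index set0 (inPsi x)) -/(alpha x) E.
      by rewrite nth_index.
    by rewrite /alpha (block_eq toicPsi (block_in toicPsi v) xv).
  have ok : coloring_ok k (facts_of e alpha).
    apply/(coloring_okP eG a9); split=> [v|v]; first by have := aP v; lia.
    have [Y YP /andP[Yv XY]] := partner toicPsi (block_in toicPsi v).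
    have [w wY] := block_inhab toicPsi YP; have E := block_eq toicPsi YP wY.
    exists w; last by rewrite !cls E.
    apply: contra Yv => /eqP aa.
    by rewrite -E -(cls w) aa cls.
  exists alpha; rewrite /bonus ok; split=> //; first by rewrite addn1.
  rewrite addn1 addnS ltnS; apply: leq_trans rPsi _; apply: leq_trans _ (leq_addl _ _).
  rewrite (@big_cat_nat _ _ _ #|Psi|) //=; apply: leq_trans _ (leq_addr _ _).
  rewrite (eq_big_nat _ _ (F2 := fun=> 1)); first by rewrite sum_nat_const_nat subn0 muln1.
  move=> p /andP[_ pP]; have -> // : present k (facts_of e alpha) p.
  have pE : p < size (enum Psi) by rewrite -cardE.
  have XP : nth set0 (enum Psi) p \in Psi by rewrite -mem_enum mem_nth.
  have [v vX] := block_inhab toicPsi XP; apply/(presentP eG); exists v.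
  by rewrite /alpha (block_eq toicPsi XP vX) index_uniq // enum_uniq.
have [u0 [cardN N0 indep nbr Hmin]] := min_neighbourhood toicPsi big.
pose alpha v := if v \in nbhd u0 then 7 else if nbhd v \subset nbhd u0 then 6 else 8.
have a9 v : alpha v < 9 by rewrite /alpha; do !case: ifP.
have a6 v : 6 <= alpha v by rewrite /alpha; do !case: ifP.
have al7 v : (alpha v == 7) = (v \in nbhd u0) by rewrite /alpha; do !case: ifP.
have al6 v : alpha v = 6 -> v \notin nbhd u0 /\ nbhd v = nbhd u0.
  by rewrite /alpha; case: ifP => // _; case: ifP => // /Hmin[_ E] _.
have u06 : alpha u0 = 6.
  by rewrite /alpha inE edge_irrefl subxx.
have star : star_ok k (facts_of e alpha).
  apply/(star_okP eG a9); split=> //; first by exists u0.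
    by have /set0Pn[s sN] := N0; exists s; apply/eqP; rewrite al7.
  split.
  - move=> u v uv /al6[_ E]; apply/eqP; rewrite al7 -E inE //.
  - move=> u v uv /eqP; rewrite !al7 => uN; apply/negP => vN.
    by have := indep u v uN vN; rewrite uv.
  - move=> v; rewrite /alpha; case: ifP => // vN; case: ifP => // /negbT/subsetPn[w vw wN] _.
    exists w; first by rewrite inE in vw.
    rewrite (negPf wN); case: ifP => // /Hmin[_ E].
    have : v \in nbhd u0 by rewrite -E inE edge_sym; rewrite inE in vw.
    by rewrite vN.
  - by move=> u s /al6[_ E] /eqP; rewrite al7 -E inE.
have notcol : coloring_ok k (facts_of e alpha) = false.
  by apply/negP => /(coloring_okP eG a9)[/(_ u0)]; rewrite u06.
exists alpha; rewrite /bonus notcol star; split=> //.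
rewrite (weightE eG) (_ : [set v | alpha v == 7] = nbhd u0); first by rewrite addn2 !ltnS; lia.
by apply/setP => v; rewrite inE al7.
Qed.

End Graph.

(** * The decision procedure *)

Lemma kexpr_code_le (V : finType) k (e : kexpr V k) m :
  3 <= m -> k <= m -> #|V| <= m -> all (fun x => x <= m) (kexpr_code e).
Proof.
move=> m3 km Vm; have lab (i : 'I_k) : i <= m by have := ltn_ord i; lia.
elim: e => [i v|e1 IH1 e2 IH2|i j e IH|i j e IH] /=.
- by rewrite lab (leq_trans _ Vm) // ltnW.
- by rewrite !all_cat IH1 IH2 /= andbT; lia.
- by rewrite all_cat IH /= !lab; lia.
- by rewrite all_cat IH /= !lab; lia.
Qed.

Theorem theorem3 :
  exists (P : seq instr) (f : nat -> nat),
  forall (G : sgraph) (k c r w : nat) (e : kexpr G k),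
    is_clique_width G w -> w <= k ->
    kexpr_of e -> kexpr_size e <= c * #|G| ->
    decides_within P (toic_input r e) (r <= toi_coalition_number G)
      (f k * (c * #|G|)) (f k * (c * #|G| + r)).
Proof.
have [P [f Hf]] := run_program init_le2 width_computable init_computable
  trans_computable final_computable trans1.
exists P, f => G k c r w e _ _ eG sz.
have wf : kexpr_wf e by case: eG.
have size_gt0 : 0 < kexpr_size e by case: (e).
have N0 : 0 < c * #|G| by lia.
have -> : (r <= toi_coalition_number G) = (r <= best width final k (table e)).
  have [->//|r0] := posnP r; apply/idP/idP => [rC|/(best_table wf r0)[alpha [a9 b0 H]]].
    by apply/(best_table wf r0); apply: annotation_exists.
  by have := annotation_le eG a9 b0; lia.
rewrite /toic_input -ops_code_ops; apply: Hf => //.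
- exact: run_ops_table.
- exact: ops_le3.
- by rewrite size_ops.
- rewrite ops_code_ops; apply: kexpr_code_le; [lia|lia|].
  have : #|G| <= c * #|G| by apply: leq_pmull; case: (c) N0.
  lia.
Qed.
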